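(* Let $k$ be a field and let $A$ be an Artinian $k$-algebra which is splitting over its radical. Let $\Delta_A$ be the natural quiver of $A$ and $k(\Delta_A,\mathcal A)$ the associated generalized path algebra of $A$, with ideal $J$ generated by all virtual $\mathcal A$-paths of length $1$. Then there is a surjective $k$-algebra homomorphism $\phi:k(\Delta_A,\mathcal A)\rightarrow A$ with $J^s\subseteq \ker(\phi)\subseteq J$ for some positive integer $s$.
   Context: Artinian means left Artinian. Let $r$ be the Jacobson radical of $A$. $A$ is splitting over its radical if there is a $k$-algebra homomorphism $\rho:A/r\to A$ with $\pi\circ\rho=\mathrm{Id}_{A/r}$, where $\pi:A\to A/r$ is the quotient map. Write $A/r=\bigoplus_{i\in\Delta_0}A_i$ with $A_i$ two-sided simple ideals (simple algebras). Natural quiver $\Delta_A$: vertex set $\Delta_0$; the number $t_{ij}$ of arrows from $i$ to $j$ is the minimal number of generators of $A_j\cdot(r/r^2)\cdot A_i$ as an $A_j$-$A_i$-bimodule ($0$ if this bimodule is zero). Associated generalized path algebra: let $\mathcal A=\{A_i : i\in\Delta_0\}$, $A_0=\prod_{i}A_i$, let $\Omega(i,j)$ be the set of arrows from $i$ to $j$ in $\Delta_A$, let $A_j\Omega(i,j)A_i$ be the free $A_j$-$A_i$-bimodule (free $A_j\otimes_kA_i^{op}$-module) with basis $\Omega(i,j)$, and $M=\bigoplus_{i,j}A_j\Omega(i,j)A_i$, an $A_0$-$A_0$-bimodule. Then $k(\Delta_A,\mathcal A)=T_{A_0}(M)=\bigoplus_{n\ge0}M^{\otimes_{A_0}n}$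 is the tensor algebra (with $M^{\otimes_{A_0}0}=A_0$), elements of $M^{\otimes_{A_0}n}$ are the virtual $\mathcal A$-paths of length $n$, and $J=\bigoplus_{n\ge1}M^{\otimes_{A_0}n}$. *)

(* Defs.v *)
From HB Require Import structures.
From mathcomp Require Import all_boot all_algebra.
From mathcomp Require Import boolp classical_sets.
From mathcomp Require Import freeg.

Set Implicit Arguments.
Unset Strict Implicit.
Unset Printing Implicit Defensive.

Import GRing.Theory.
Local Open Scope classical_set_scope.
Local Open Scope ring_scope.

Section Submodules.
Variables (k : fieldType) (V : lmodType k).

Record submod := Submod {
  submod_set :> V -> Prop;
  submod0 : submod_set 0;
  submodD : forall x y, submod_set x -> submod_set y -> submod_set (x + y);
  submodZ : forall (c : k) x, submod_set x -> submod_set (c *: x) }.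

Lemma submodN (N : submod) x : N x -> N (- x).
Proof. by move=> Nx; rewrite -scaleN1r; apply: submodZ. Qed.

Lemma submodB (N : submod) x y : N x -> N y -> N (x - y).
Proof. by move=> Nx Ny; apply: submodD => //; apply: submodN. Qed.

Definition submod_pred (N : submod) : {pred V} := fun x => `[< N x >].

Lemma submod_predP (N : submod) x : reflect (N x) (x \in submod_pred N).
Proof. exact: asboolP. Qed.

Fact submod_pred_closed (N : submod) : submod_closed (submod_pred N).
Proof.
split=> [|c x y /submod_predP Nx /submod_predP Ny]; apply/submod_predP.
  exact: submod0.
by apply: submodD => //; apply: submodZ.
Qed.
HB.instance Definition _ (N : submod) :=
  GRing.isSubmodClosed.Build k V (submod_pred N) (submod_pred_closed N).

Definition subm (N : submod) : Type := {x : V | x \in submod_pred N}.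
HB.instance Definition _ N := [isSub of subm N for sval].
HB.instance Definition _ N := [Choice of subm N by <:].
HB.instance Definition _ N := [SubChoice_isSubLmodule of subm N by <:].

Definition Subm (N : submod) x (Nx : N x) : subm N :=
  exist _ x (introT (submod_predP N x) Nx).

Lemma submP (N : submod) (x : subm N) : N (val x).
Proof. exact/submod_predP/(valP x). Qed.

Definition lquot (N : submod) : Type := Quotient.quot (submod_pred N).
HB.instance Definition _ N := GRing.Zmodule.on (lquot N).

Section Lquot.
Variable N : submod.

Definition qpi (x : V) : lquot N := \pi_(Quotient.quot (submod_pred N))%qT x.
Definition qrepr (q : lquot N) : V :=
  generic_quotient.repr (q : Quotient.quot (submod_pred N)).

Lemma qreprK q : qpi (qrepr q) = q.
Proof. exact: generic_quotient.reprK. Qed.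

Lemma qpi_eq x y : qpi x = qpi y <-> N (x - y).
Proof.
split=> [/eqP|Nxy]; last apply/eqP.
  by rewrite /qpi -Quotient.idealrBE => /submod_predP.
by rewrite /qpi -Quotient.idealrBE; apply/submod_predP.
Qed.

Lemma qpi_reprB x : N (qrepr (qpi x) - x).
Proof. by apply/qpi_eq; rewrite qreprK. Qed.

Lemma qpiD x y : qpi (x + y) = qpi x + qpi y.
Proof. by rewrite /qpi; exact: Quotient.pi_add. Qed.

Definition qscale (c : k) (q : lquot N) : lquot N := qpi (c *: qrepr q).

Lemma qpiZ c x : qpi (c *: x) = qscale c (qpi x).
Proof.
apply/qpi_eq; rewrite -scalerBr; apply: submodZ.
by rewrite -opprB; apply/submodN/qpi_reprB.
Qed.

Fact qscaleA a b v : qscale a (qscale b v) = qscale (a * b) v.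
Proof. by rewrite -(qreprK v) -!qpiZ scalerA. Qed.
Fact qscale1 : left_id 1 qscale.
Proof. by move=> v; rewrite -(qreprK v) -qpiZ scale1r. Qed.
Fact qscaleDr : right_distributive qscale +%R.
Proof.
by move=> c u v; rewrite -(qreprK u) -(qreprK v) -qpiD -!qpiZ -qpiD scalerDr.
Qed.
Fact qscaleDl v : {morph qscale^~ v : a b / a + b}.
Proof. by move=> a b; rewrite -(qreprK v) -!qpiZ -qpiD scalerDl. Qed.
HB.instance Definition _ := GRing.Zmodule_isLmodule.Build k (lquot N)
  qscaleA qscale1 qscaleDr qscaleDl.

Fact qpi_linear : linear qpi.
Proof. by move=> c x y; rewrite qpiD qpiZ. Qed.
HB.instance Definition _ := GRing.isLinear.Build k V (lquot N) _ qpi qpi_linear.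

Lemma qpi0 x : qpi x = 0 <-> N x.
Proof. by rewrite -{2}(subr0 x) -qpi_eq linear0. Qed.

End Lquot.

Definition spanm (X : set V) : set V :=
  fun v => forall N : submod, (forall x, X x -> N x) -> N v.

Fact spanm0 X : spanm X 0.
Proof. by move=> N _; apply: submod0. Qed.
Fact spanmD X x y : spanm X x -> spanm X y -> spanm X (x + y).
Proof. by move=> Xx Xy N XN; apply: submodD; [apply: Xx|apply: Xy]. Qed.
Fact spanmZ X c x : spanm X x -> spanm X (c *: x).
Proof. by move=> Xx N XN; apply: submodZ; apply: Xx. Qed.

Definition span (X : set V) : submod :=
  Submod (@spanm0 X) (@spanmD X) (@spanmZ X).

End Submodules.

Section Ideals.
Variables (k : fieldType) (A : algType k).

Definition left_ideal (I : set A) : Prop :=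
  [/\ I 0, forall x y, I x -> I y -> I (x + y) & forall a x, I x -> I (a * x)].

Definition two_sided_ideal (I : set A) : Prop :=
  left_ideal I /\ forall x a, I x -> I (x * a).

Definition left_artinian : Prop :=
  forall I : nat -> set A, (forall n, left_ideal (I n)) ->
    (forall n, I n.+1 `<=` I n) ->
  exists n, forall m, (n <= m)%N -> I m = I n.

Definition maximal_left_ideal (I : set A) : Prop :=
  [/\ left_ideal I, ~ I 1 &
      forall J, left_ideal J -> I `<=` J -> ~ J 1 -> J = I].

Definition jacobson : set A :=
  fun x => forall I, maximal_left_ideal I -> I x.

Lemma left_idealZ I c x : left_ideal I -> I x -> I (c *: x).
Proof. by case=> _ _ IM Ix; rewrite -[x]mul1r scalerAl; apply: IM. Qed.

Record ideal := Ideal {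
  ideal_set :> A -> Prop;
  ideal_two_sided : two_sided_ideal ideal_set }.

Lemma ideal0 (I : ideal) : I 0.
Proof. by case: (ideal_two_sided I) => -[]. Qed.
Lemma idealD (I : ideal) x y : I x -> I y -> I (x + y).
Proof. by case: (ideal_two_sided I) => -[_ + _ _]; apply. Qed.
Lemma idealMl (I : ideal) a x : I x -> I (a * x).
Proof. by case: (ideal_two_sided I) => -[_ _ + _]; apply. Qed.
Lemma idealMr (I : ideal) x a : I x -> I (x * a).
Proof. by case: (ideal_two_sided I) => _; apply. Qed.
Lemma idealZ (I : ideal) c x : I x -> I (c *: x).
Proof. by apply: left_idealZ; case: (ideal_two_sided I). Qed.

Definition ideal_submod (I : ideal) : submod A :=
  Submod (ideal0 I) (@idealD I) (@idealZ I).

Definition idealgen (X : set A) : set A :=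
  fun x => forall I : ideal, (forall y, X y -> I y) -> I x.

Definition idealM (I J : set A) : set A :=
  spanm [set z | exists x y, [/\ I x, J y & z = x * y]].

Fixpoint idealX (I : set A) (n : nat) : set A :=
  if n is m.+1 then idealM I (idealX I m) else setT.

Lemma jacobson_left : left_ideal jacobson.
Proof.
split=> [I|x y Jx Jy I mI|a x Jx I mI]; first by case=> -[].
- by have [[_ ID _] _ _] := mI; apply: ID; [apply: Jx|apply: Jy].
- by have [[_ _ IM] _ _] := mI; apply: IM; apply: Jx.
Qed.

Lemma maximal_left_transporter (I : set A) a : maximal_left_ideal I -> ~ I a ->
  maximal_left_ideal [set x | I (x * a)].
Proof.
move=> [[I0 ID IM] I1 maxI] nIa; split=> [||J [J0 JD JM] sIJ nJ1].
- split=> [|x y|b x] /=; first by rewrite mul0r.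
    by rewrite mulrDl; apply: ID.
  by rewrite -mulrA; apply: IM.
- by rewrite /= mul1r.
apply/seteqP; split=> // y Jy /=; apply: contrapT => nIya; apply: nJ1.
pose K : set A := fun z => exists b m, I m /\ z = b * (y * a) + m.
have lK : left_ideal K.
  split=> [|_ _ [b [m [Im ->]]] [b' [m' [Im' ->]]]|c _ [b [m [Im ->]]]].
  - by exists 0, 0; rewrite mul0r addr0.
  - by exists (b + b'), (m + m'); rewrite mulrDl addrACA; split=> //; apply: ID.
  - by exists (c * b), (c * m); rewrite mulrDr mulrA; split=> //; apply: IM.
have sIK : I `<=` K by move=> m Im; exists 0, m; rewrite mul0r add0r.
have K1 : K 1.
  apply: contrapT => nK1; apply: nIya; rewrite -(maxI _ lK sIK nK1).
  by exists 1, 0; rewrite mul1r addr0.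
have [b [m [Im e1]]] := K1.
have Jby : J (1 - a * b * y).
  apply: sIJ => /=; rewrite mulrBl mul1r -!mulrA -{1}[a]mulr1 e1 mulrDr.
  by rewrite addrC addKr; apply: IM.
by rewrite -(subrK (a * b * y) 1); apply: JD => //; apply: JM.
Qed.

Lemma jacobson_two_sided : two_sided_ideal jacobson.
Proof.
split=> [|x a Jx I mI]; first exact: jacobson_left.
have [Ia|nIa] := pselect (I a); last exact: Jx (maximal_left_transporter mI nIa).
by have [[_ _ IM] _ _] := mI; apply: IM.
Qed.

Definition radical : ideal := Ideal jacobson_two_sided.

Lemma exists_maximal_left : exists I, maximal_left_ideal I.
Proof.
pose P := fun I : set A => (exists x, I x) -> left_ideal I /\ ~ I 1.
have [F FP Ftot|I [PI maxI]] := @Zorn_bigcup A P.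
  move=> [x0 [X0 FX0 X0x0]].
  have FL X x : F X -> X x -> left_ideal X /\ ~ X 1.
    by move=> /FP PX Xx; apply: PX; exists x.
  split; last by move=> [X FX X1]; have [_] := FL _ _ FX X1; apply.
  split=> [|x y [X FX Xx] [Y FY Yy]|a x [X FX Xx]].
  - by exists X0 => //; have [[]] := FL _ _ FX0 X0x0.
  - have [[_ XD _] _] := FL _ _ FX Xx; have [[_ YD _] _] := FL _ _ FY Yy.
    have [sXY|sYX] := Ftot _ _ FX FY.
      by exists Y => //; apply: YD => //; apply: sXY.
    by exists X => //; apply: XD => //; apply: sYX.
  - by exists X => //; have [[_ _ XM] _] := FL _ _ FX Xx; apply: XM.
have z0 : P [set 0].
  move=> _; split; last by move/eqP; rewrite oner_eq0.
  by split=> [//|x y -> ->|a x ->] /=; rewrite ?addr0 ?mulr0.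
have I0 : exists x, I x.
  apply: contrapT => nI; apply: (maxI _ _ z0); split=> [x Ix|s0I].
    by case: nI; exists x.
  by apply: nI; exists 0; apply: s0I.
have [lI nI1] := PI I0.
exists I; split=> // J lJ sIJ nJ1; apply: contrapT => nJI.
by apply: (maxI J) => //; split=> // sJI; apply: nJI; apply/seteqP.
Qed.

Lemma radical1 : ~ radical 1.
Proof.
have [I mI] := exists_maximal_left; move=> /(_ I mI).
by case: mI.
Qed.

End Ideals.

Section QuotientAlgebra.
Variables (k : fieldType) (A : algType k).

Record proper_ideal := ProperIdeal {
  proper_ideal_val :> ideal A;
  proper_idealP : ~ proper_ideal_val 1 }.

Variable I : proper_ideal.

Definition quotalg : Type := lquot (ideal_submod I).
HB.instance Definition _ := GRing.Lmodule.on quotalg.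

Definition quotpi (x : A) : quotalg := qpi (ideal_submod I) x.
Fact quotpi_linear : linear quotpi.
Proof. exact: qpi_linear. Qed.
HB.instance Definition _ :=
  GRing.isLinear.Build k A quotalg _ quotpi quotpi_linear.

Definition quotrepr (q : quotalg) : A := qrepr q.

Lemma quotreprK q : quotpi (quotrepr q) = q.
Proof. exact: qreprK. Qed.

Lemma quotpi_eq x y : quotpi x = quotpi y <-> I (x - y).
Proof. exact: qpi_eq. Qed.

Lemma quotpi0 x : quotpi x = 0 <-> I x.
Proof. exact: qpi0. Qed.

Definition quotmul (p q : quotalg) : quotalg := quotpi (quotrepr p * quotrepr q).

Lemma quotpi_mul x y : quotpi (x * y) = quotmul (quotpi x) (quotpi y).
Proof.
apply/quotpi_eq; set x' := quotrepr _; set y' := quotrepr _.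
have -> : x * y - x' * y' = (x - x') * y + x' * (y - y').
  by rewrite mulrBl mulrBr addrA subrK.
by apply: idealD; [apply: idealMr|apply: idealMl]; apply/quotpi_eq;
   rewrite quotreprK.
Qed.

Fact quotmulA : associative quotmul.
Proof.
move=> x y z; rewrite -(quotreprK x) -(quotreprK y) -(quotreprK z).
by rewrite -!quotpi_mul mulrA.
Qed.
Fact quotmul1l : left_id (quotpi 1) quotmul.
Proof. by move=> x; rewrite -(quotreprK x) -quotpi_mul mul1r. Qed.
Fact quotmul1r : right_id (quotpi 1) quotmul.
Proof. by move=> x; rewrite -(quotreprK x) -quotpi_mul mulr1. Qed.
Fact quotmulDl : left_distributive quotmul +%R.
Proof.
move=> x y z; rewrite -(quotreprK x) -(quotreprK y) -(quotreprK z).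
by rewrite -linearD -!quotpi_mul -linearD mulrDl.
Qed.
Fact quotmulDr : right_distributive quotmul +%R.
Proof.
move=> x y z; rewrite -(quotreprK x) -(quotreprK y) -(quotreprK z).
by rewrite -linearD -!quotpi_mul -linearD mulrDr.
Qed.
Fact quot1_neq0 : quotpi 1 != 0.
Proof. by apply/eqP => /quotpi0; apply: proper_idealP. Qed.
HB.instance Definition _ := GRing.Zmodule_isNzRing.Build quotalg
  quotmulA quotmul1l quotmul1r quotmulDl quotmulDr quot1_neq0.

Lemma quotpiM x y : quotpi (x * y) = quotpi x * quotpi y.
Proof. exact: quotpi_mul. Qed.

Fact quotscaleAl (c : k) (x y : quotalg) : c *: (x * y) = (c *: x) * y.
Proof.
rewrite -(quotreprK x) -(quotreprK y); move: (quotrepr x) (quotrepr y) => u v.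
have Z w : c *: quotpi w = quotpi (c *: w) by rewrite linearZ.
by rewrite Z -!quotpiM Z scalerAl.
Qed.
HB.instance Definition _ := GRing.Lmodule_isLalgebra.Build k quotalg quotscaleAl.

Fact quotscaleAr (c : k) (x y : quotalg) : c *: (x * y) = x * (c *: y).
Proof.
rewrite -(quotreprK x) -(quotreprK y); move: (quotrepr x) (quotrepr y) => u v.
have Z w : c *: quotpi w = quotpi (c *: w) by rewrite linearZ.
by rewrite Z -!quotpiM Z scalerAr.
Qed.
HB.instance Definition _ := GRing.Lalgebra_isAlgebra.Build k quotalg quotscaleAr.

Fact quotpi_monoid_morphism : monoid_morphism quotpi.
Proof. by split=> // x y; rewrite quotpi_mul. Qed.
HB.instance Definition _ :=
  GRing.isMonoidMorphism.Build A quotalg quotpi quotpi_monoid_morphism.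

End QuotientAlgebra.

Definition jrad (k : fieldType) (A : algType k) : proper_ideal A :=
  ProperIdeal (@radical1 k A).

Definition splits_over_radical (k : fieldType) (A : algType k) : Prop :=
  exists rho : {lrmorphism quotalg (jrad A) -> A},
    forall x, quotpi (jrad A) (rho x) = x.

Section BimoduleDef.
Variables (k : fieldType) (R S : algType k).

(* The two actions induce the same action of k, so that an R-S-bimodule is a
   module over the tensor product over k of R and S^op. *)
Record bimod := Bimod {
  bcar :> lmodType k;
  lact : R -> bcar -> bcar;
  ract : bcar -> S -> bcar;
  lact1 : forall x, lact 1 x = x;
  lactA : forall a b x, lact (a * b) x = lact a (lact b x);
  lactDl : forall a b x, lact (a + b) x = lact a x + lact b x;
  lactDr : forall a x y, lact a (x + y) = lact a x + lact a y;
  lactZl : forall c a x, lact (c *: a) x = c *: lact a x;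
  lactZr : forall c a x, lact a (c *: x) = c *: lact a x;
  ract1 : forall x, ract x 1 = x;
  ractA : forall x a b, ract x (a * b) = ract (ract x a) b;
  ractDl : forall x y b, ract (x + y) b = ract x b + ract y b;
  ractDr : forall x a b, ract x (a + b) = ract x a + ract x b;
  ractZl : forall c x b, ract (c *: x) b = c *: ract x b;
  ractZr : forall c x b, ract x (c *: b) = c *: ract x b;
  lractA : forall a x b, lact a (ract x b) = ract (lact a x) b }.

Definition sub_bimodule (X : set R) (Y : set S) (B : bimod) (N : submod B) :=
  (forall a x, X a -> N x -> N (lact a x)) /\
  (forall x b, Y b -> N x -> N (ract x b)).

Definition bimod_gen (X : set R) (Y : set S) (B : bimod) (G : set B) : set B :=
  fun x => forall N : submod B, sub_bimodule X Y N -> (forall g, G g -> N g) -> N x.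

Definition sandwich (X : set R) (B : bimod) (Y : set S) : set B :=
  spanm [set z | exists a x b, [/\ X a, Y b & z = lact a (ract x b)]].

End BimoduleDef.
Arguments sandwich {k R S} X B Y.
Arguments lact {k R S B} _ _ : rename.
Arguments ract {k R S B} _ _ : rename.

Section Regular.
Variables (k : fieldType) (R : algType k).

Program Definition reg_bimod : bimod R R :=
  @Bimod k R R R (fun a x => a * x) (fun x b => x * b)
    _ _ _ _ _ _ _ _ _ _ _ _ _.
Next Obligation. exact: mul1r. Qed.
Next Obligation. by rewrite mulrA. Qed.
Next Obligation. exact: mulrDl. Qed.
Next Obligation. exact: mulrDr. Qed.
Next Obligation. by rewrite scalerAl. Qed.
Next Obligation. by rewrite scalerAr. Qed.
Next Obligation. exact: mulr1. Qed.
Next Obligation. by rewrite mulrA. Qed.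
Next Obligation. exact: mulrDl. Qed.
Next Obligation. exact: mulrDr. Qed.
Next Obligation. by rewrite scalerAl. Qed.
Next Obligation. by rewrite scalerAr. Qed.
Next Obligation. by rewrite mulrA. Qed.

Program Definition lreg_bimod : bimod R k^o :=
  @Bimod k R k^o R (fun a x => a * x) (fun x c => (c : k) *: x)
    _ _ _ _ _ _ _ _ _ _ _ _ _.
Next Obligation. exact: mul1r. Qed.
Next Obligation. by rewrite mulrA. Qed.
Next Obligation. exact: mulrDl. Qed.
Next Obligation. exact: mulrDr. Qed.
Next Obligation. by rewrite scalerAl. Qed.
Next Obligation. by rewrite scalerAr. Qed.
Next Obligation. exact: scale1r. Qed.
Next Obligation. by rewrite mulrC scalerA. Qed.
Next Obligation. exact: scalerDr. Qed.
Next Obligation. exact: scalerDl. Qed.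
Next Obligation. by rewrite !scalerA mulrC. Qed.
Next Obligation. by rewrite scalerA. Qed.
Next Obligation. by rewrite scalerAr. Qed.

Program Definition rreg_bimod : bimod k^o R :=
  @Bimod k k^o R R (fun c x => (c : k) *: x) (fun x b => x * b)
    _ _ _ _ _ _ _ _ _ _ _ _ _.
Next Obligation. exact: scale1r. Qed.
Next Obligation. by rewrite scalerA. Qed.
Next Obligation. exact: scalerDl. Qed.
Next Obligation. exact: scalerDr. Qed.
Next Obligation. by rewrite scalerA. Qed.
Next Obligation. by rewrite !scalerA mulrC. Qed.
Next Obligation. exact: mulr1. Qed.
Next Obligation. by rewrite mulrA. Qed.
Next Obligation. exact: mulrDl. Qed.
Next Obligation. exact: mulrDr. Qed.
Next Obligation. by rewrite scalerAl. Qed.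
Next Obligation. by rewrite scalerAr. Qed.
Next Obligation. by rewrite scalerAl. Qed.

End Regular.

Section Restriction.
Variables (k : fieldType) (R R' S S' : algType k).
Variables (f : {lrmorphism R' -> R}) (g : {lrmorphism S' -> S}) (B : bimod R S).

Program Definition restr_bimod : bimod R' S' :=
  @Bimod k R' S' B (fun a x => lact (f a) x) (fun x b => ract x (g b))
    _ _ _ _ _ _ _ _ _ _ _ _ _.
Next Obligation. by rewrite rmorph1 lact1. Qed.
Next Obligation. by rewrite rmorphM lactA. Qed.
Next Obligation. by rewrite rmorphD lactDl. Qed.
Next Obligation. exact: lactDr. Qed.
Next Obligation. by rewrite linearZ lactZl. Qed.
Next Obligation. exact: lactZr. Qed.
Next Obligation. by rewrite rmorph1 ract1. Qed.
Next Obligation. by rewrite rmorphM ractA. Qed.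
Next Obligation. exact: ractDl. Qed.
Next Obligation. by rewrite rmorphD ractDr. Qed.
Next Obligation. exact: ractZl. Qed.
Next Obligation. by rewrite linearZ ractZr. Qed.
Next Obligation. exact: lractA. Qed.

End Restriction.

Section Dprod.
Variables (k : fieldType) (I : Type) (V : I -> lmodType k).

Definition dprod : Type := forall i, V i.
HB.instance Definition _ := gen_eqMixin dprod.
HB.instance Definition _ := gen_choiceMixin dprod.

Definition dprod_add (f g : dprod) : dprod := fun i => f i + g i.
Definition dprod_opp (f : dprod) : dprod := fun i => - f i.
Definition dprod_zero : dprod := fun=> 0.
Definition dprod_scale (c : k) (f : dprod) : dprod := fun i => c *: f i.

Fact dprod_addA : associative dprod_add.
Proof. by move=> f g h; apply: functional_extensionality_dep => i; exact: addrA. Qed.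
Fact dprod_addC : commutative dprod_add.
Proof. by move=> f g; apply: functional_extensionality_dep => i; exact: addrC. Qed.
Fact dprod_add0 : left_id dprod_zero dprod_add.
Proof. by move=> f; apply: functional_extensionality_dep => i; exact: add0r. Qed.
Fact dprod_addN : left_inverse dprod_zero dprod_opp dprod_add.
Proof. by move=> f; apply: functional_extensionality_dep => i; exact: addNr. Qed.
HB.instance Definition _ := GRing.isZmodule.Build dprod
  dprod_addA dprod_addC dprod_add0 dprod_addN.

Fact dprod_scaleA a b f : dprod_scale a (dprod_scale b f) = dprod_scale (a * b) f.
Proof. by apply: functional_extensionality_dep => i; exact: scalerA. Qed.
Fact dprod_scale1 : left_id 1 dprod_scale.
Proof. by move=> f; apply: functional_extensionality_dep => i; exact: scale1r. Qed.
Fact dprod_scaleDr : right_distributive dprod_scale +%R.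
Proof. by move=> c f g; apply: functional_extensionality_dep => i; exact: scalerDr. Qed.
Fact dprod_scaleDl f : {morph dprod_scale^~ f : a b / a + b}.
Proof. by move=> a b; apply: functional_extensionality_dep => i; exact: scalerDl. Qed.
HB.instance Definition _ := GRing.Zmodule_isLmodule.Build k dprod
  dprod_scaleA dprod_scale1 dprod_scaleDr dprod_scaleDl.

Lemma dprodP (f g : dprod) : (forall i, f i = g i) -> f = g.
Proof. exact: functional_extensionality_dep. Qed.

Lemma dprodD (f g : dprod) i : (f + g) i = f i + g i. Proof. by []. Qed.
Lemma dprod0 i : (0 : dprod) i = 0. Proof. by []. Qed.
Lemma dprodZ c (f : dprod) i : (c *: f) i = c *: f i. Proof. by []. Qed.
Lemma dprod_sum J (r : seq J) (P : pred J) (F : J -> dprod) i :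
  (\sum_(j <- r | P j) F j) i = \sum_(j <- r | P j) F j i.
Proof. by elim/big_rec2: _ => // j x y _ <-. Qed.

End Dprod.

Section ProductBimodule.
Variables (k : fieldType) (R S : algType k) (I : Type) (B : I -> bimod R S).

Let V := dprod (fun i => bcar (B i)).

Program Definition prod_bimod : bimod R S :=
  @Bimod k R S V (fun a f i => lact a (f i)) (fun f b i => ract (f i) b)
    _ _ _ _ _ _ _ _ _ _ _ _ _.
Next Obligation. by apply: dprodP => i; exact: lact1. Qed.
Next Obligation. by apply: dprodP => i; exact: lactA. Qed.
Next Obligation. by apply: dprodP => i; exact: lactDl. Qed.
Next Obligation. by apply: dprodP => i; exact: lactDr. Qed.
Next Obligation. by apply: dprodP => i; exact: lactZl. Qed.
Next Obligation. by apply: dprodP => i; exact: lactZr. Qed.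
Next Obligation. by apply: dprodP => i; exact: ract1. Qed.
Next Obligation. by apply: dprodP => i; exact: ractA. Qed.
Next Obligation. by apply: dprodP => i; exact: ractDl. Qed.
Next Obligation. by apply: dprodP => i; exact: ractDr. Qed.
Next Obligation. by apply: dprodP => i; exact: ractZl. Qed.
Next Obligation. by apply: dprodP => i; exact: ractZr. Qed.
Next Obligation. by apply: dprodP => i; exact: lractA. Qed.

End ProductBimodule.

Section TensorCarrier.
Variables (k : fieldType) (R S T : algType k) (X : bimod R S) (Y : bimod S T).

Local Notation F := {freeg (X * Y) / k}.
Local Notation pt x y := (<< (x, y) >> : F).

(* Compatibility with scalars in the second argument follows from the last
   relation, see tensZr below. *)
Definition tensor_rel : set F := fun z =>
  [\/ exists x x' y, z = pt (x + x') y - pt x y - pt x' y,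
      exists x y y', z = pt x (y + y') - pt x y - pt x y',
      exists c x y, z = pt (c *: x) y - c *: pt x y |
      exists x s y, z = pt (ract x s) y - pt x (lact s y)].

Definition tensor_carrier : Type := lquot (span tensor_rel).
HB.instance Definition _ := GRing.Lmodule.on tensor_carrier.

Definition tens (x : X) (y : Y) : tensor_carrier :=
  qpi (span tensor_rel) (pt x y).

Record balanced (V : lmodType k) (b : X -> Y -> V) : Prop := Balanced {
  balDl : forall x x' y, b (x + x') y = b x y + b x' y;
  balDr : forall x y y', b x (y + y') = b x y + b x y';
  balZl : forall c x y, b (c *: x) y = c *: b x y;
  balA : forall x s y, b (ract x s) y = b x (lact s y) }.

Lemma tens_balanced : balanced tens.
Proof.
split=> [x x' y|x y y'|c x y|x s y]; apply: subr0_eq; rewrite /tens.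
- rewrite opprD addrA -!linearB; apply/qpi0 => N; apply.
  by constructor 1; exists x, x', y.
- rewrite opprD addrA -!linearB; apply/qpi0 => N; apply.
  by constructor 2; exists x, y, y'.
- rewrite -linearZ -linearB; apply/qpi0 => N; apply.
  by constructor 3; exists c, x, y.
- rewrite -linearB; apply/qpi0 => N; apply.
  by constructor 4; exists x, s, y.
Qed.

Section Lift.
Variables (V : lmodType k) (b : X -> Y -> V).

Definition flift (z : F) : V := fglift (fun p => b p.1 p.2) z.

Fact flift_linear : linear flift.
Proof.
have D : {morph flift : x y / x + y}.
  by move=> x y; apply: (addIr (- flift y)); rewrite -lift_is_additive !addrK.
have Z0 : flift 0 = 0 by rewrite -[0](subrr 0) /flift lift_is_additive subrr.
move=> c x y; rewrite D; congr (_ + _); elim/freeg_ind_dom0: x.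
  by rewrite scaler0 Z0 scaler0.
move=> d p z _ _ IH; rewrite scalerDr !D IH scalerDr; congr (_ + _).
have -> : c *: << d *g p >> = << c * d *g p >> :> F.
  by apply/eqP/freeg_eqP => q; rewrite coeffZ !coeffU mulrA.
by rewrite /flift !liftU scalerA.
Qed.
HB.instance Definition _ := GRing.isLinear.Build k F V _ flift flift_linear.

Lemma flift_pt x y : flift (pt x y) = b x y.
Proof. by rewrite /flift liftU scale1r. Qed.

(* The linear map on the tensor product induced by b, if b is balanced. *)
Definition tlift (z : tensor_carrier) : V := flift (qrepr z).

Hypothesis bal : balanced b.

Lemma flift_rel z : span tensor_rel z -> flift z = 0.
Proof.
pose N : submod F := @Submod k F (fun z => flift z = 0) (linear0 _)
  (fun x y fx fy => etrans (linearD _ x y) (etrans (f_equal2 _ fx fy) (addr0 0)))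
  (fun c x fx => etrans (linearZ _ x) (etrans (f_equal _ fx) (scaler0 _ c))).
move=> /(_ N); apply=> {}z /=; case.
- by move=> [x [x' [y ->]]]; rewrite !linearB /= !flift_pt balDl// addrAC addrK subrr.
- by move=> [x [y [y' ->]]]; rewrite !linearB /= !flift_pt balDr// addrAC addrK subrr.
- by move=> [c [x [y ->]]]; rewrite linearB linearZ /= !flift_pt balZl// subrr.
- by move=> [x [s [y ->]]]; rewrite linearB /= !flift_pt balA// subrr.
Qed.

Lemma tlift_qpi z : tlift (qpi (span tensor_rel) z) = flift z.
Proof.
by apply: subr0_eq; rewrite /tlift -linearB; apply/flift_rel/qpi_reprB.
Qed.

Lemma tlift_tens x y : tlift (tens x y) = b x y.
Proof. by rewrite tlift_qpi flift_pt. Qed.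

Lemma tlift_linear : linear tlift.
Proof.
move=> c u v; rewrite -(qreprK u) -(qreprK v) -linearP !tlift_qpi.
exact: linearP.
Qed.

Lemma tliftD u v : tlift (u + v) = tlift u + tlift v.
Proof. by rewrite -[u]scale1r tlift_linear !scale1r. Qed.
Lemma tliftZ c u : tlift (c *: u) = c *: tlift u.
Proof.
have tlift0 : tlift 0 = 0.
  by apply: (addrI (tlift 0)); rewrite -tliftD !addr0.
by rewrite -[c *: u]addr0 tlift_linear tlift0 addr0.
Qed.

End Lift.

Lemma tensor_ind (P : tensor_carrier -> Prop) :
  P 0 -> (forall u v, P u -> P v -> P (u + v)) -> (forall x y, P (tens x y)) ->
  forall u, P u.
Proof.
move=> P0 PD Pt u; rewrite -(qreprK u); elim/freeg_ind_dom0: (qrepr u).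
  by rewrite linear0.
move=> d [x y] z _ _ IH; rewrite qpiD; apply: PD => //.
have -> : << d *g (x, y) >> = d *: pt x y.
  by apply/eqP/freeg_eqP => q; rewrite coeffZ !coeffU mul1r.
have -> : qpi (span tensor_rel) (d *: pt x y) = d *: tens x y by exact: linearZ.
by rewrite -(balZl tens_balanced); apply: Pt.
Qed.

Lemma tensor_ext (V : lmodType k) (f g : tensor_carrier -> V) :
  (forall u v, f (u + v) = f u + f v) -> (forall u v, g (u + v) = g u + g v) ->
  (forall x y, f (tens x y) = g (tens x y)) -> forall u, f u = g u.
Proof.
move=> fD gD fg; elim/tensor_ind => [|u v fu fv|//].
  by apply: (addrI (f 0)); rewrite -fD addr0 (_ : f 0 = 0) ?add0r;
    [apply: (addrI (g 0)); rewrite -gD !addr0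
    |apply: (addrI (f 0)); rewrite -fD !addr0].
by rewrite fD gD fu fv.
Qed.

End TensorCarrier.

Section Tensor.
Variables (k : fieldType) (R S T : algType k) (X : bimod R S) (Y : bimod S T).

Let tlactf (a : R) (x : X) (y : Y) : tensor_carrier X Y := tens (lact a x) y.
Let tractf (b : T) (x : X) (y : Y) : tensor_carrier X Y := tens x (ract y b).

Lemma tlactf_balanced a : balanced (tlactf a).
Proof.
have [Dl Dr Zl Al] := tens_balanced X Y.
split=> [x x' y|x y y'|c x y|x s y]; rewrite /tlactf ?lactDr ?lactZr//.
by rewrite lractA Al.
Qed.

Lemma tractf_balanced b : balanced (tractf b).
Proof.
have [Dl Dr Zl Al] := tens_balanced X Y.
split=> [x x' y|x y y'|c x y|x s y]; rewrite /tractf ?ractDl ?ractZl//.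
by rewrite -lractA Al.
Qed.

Definition tlact (a : R) : tensor_carrier X Y -> tensor_carrier X Y :=
  tlift (tlactf a).
Definition tract (u : tensor_carrier X Y) (b : T) : tensor_carrier X Y :=
  tlift (tractf b) u.

Lemma tlact_tens a x y : tlact a (tens x y) = tens (lact a x) y.
Proof. exact/tlift_tens/tlactf_balanced. Qed.
Lemma tract_tens b x y : tract (tens x y) b = tens x (ract y b).
Proof. exact/tlift_tens/tractf_balanced. Qed.
Lemma tlactD a u v : tlact a (u + v) = tlact a u + tlact a v.
Proof. exact/tliftD/tlactf_balanced. Qed.
Lemma tractD b u v : tract (u + v) b = tract u b + tract v b.
Proof. exact/tliftD/tractf_balanced. Qed.
Lemma tlactZ a c u : tlact a (c *: u) = c *: tlact a u.
Proof. exact/tliftZ/tlactf_balanced. Qed.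
Lemma tractZ b c u : tract (c *: u) b = c *: tract u b.
Proof. exact/tliftZ/tractf_balanced. Qed.

Lemma tensDl x x' (y : Y) : tens (x + x' : X) y = tens x y + tens x' y.
Proof. exact: balDl (tens_balanced X Y) _ _ _. Qed.
Lemma tensDr x (y y' : Y) : tens (x : X) (y + y') = tens x y + tens x y'.
Proof. exact: balDr (tens_balanced X Y) _ _ _. Qed.
Lemma tensZl c x (y : Y) : tens (c *: x : X) y = c *: tens x y.
Proof. exact: balZl (tens_balanced X Y) _ _ _. Qed.
Lemma tensA (x : X) s (y : Y) : tens (ract x s) y = tens x (lact s y).
Proof. exact: balA (tens_balanced X Y) _ _ _. Qed.
Lemma tensZr c x (y : Y) : tens (x : X) (c *: y) = c *: tens x y.
Proof.
by rewrite -[y in LHS]lact1 -lactZl -tensA ractZr ract1 tensZl.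
Qed.

Program Definition tensor : bimod R T :=
  @Bimod k R T (tensor_carrier X Y) tlact tract _ _ _ _ _ _ _ _ _ _ _ _ _.
Next Obligation.
elim/tensor_ind: x => [|u v IHu IHv|x y]; last by rewrite tlact_tens lact1.
  by rewrite -{1}(scale0r 0) tlactZ scale0r.
by rewrite tlactD IHu IHv.
Qed.
Next Obligation.
move: x; apply: tensor_ext => [u v|u v|x y]; rewrite ?tlactD//.
by rewrite !tlact_tens lactA.
Qed.
Next Obligation.
move: x; apply: tensor_ext => [u v|u v|x y]; rewrite ?tlactD// 1?addrACA//.
by rewrite !tlact_tens lactDl tensDl.
Qed.
Next Obligation. exact: tlactD. Qed.
Next Obligation.
move: x; apply: tensor_ext => [u v|u v|x y]; rewrite ?tlactD// ?scalerDr//.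
by rewrite !tlact_tens lactZl tensZl.
Qed.
Next Obligation. exact: tlactZ. Qed.
Next Obligation.
elim/tensor_ind: x => [|u v IHu IHv|x y]; last by rewrite tract_tens ract1.
  by rewrite -{1}(scale0r 0) tractZ scale0r.
by rewrite tractD IHu IHv.
Qed.
Next Obligation.
move: x; apply: tensor_ext => [u v|u v|x y]; rewrite ?tractD//.
by rewrite !tract_tens ractA.
Qed.
Next Obligation. exact: tractD. Qed.
Next Obligation.
move: x; apply: tensor_ext => [u v|u v|x y]; rewrite ?tractD// 1?addrACA//.
by rewrite !tract_tens ractDr tensDr.
Qed.
Next Obligation. exact: tractZ. Qed.
Next Obligation.
move: x; apply: tensor_ext => [u v|u v|x y]; rewrite ?tractD// ?scalerDr//.
by rewrite !tract_tens ractZr tensZr.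
Qed.
Next Obligation.
move: x; apply: tensor_ext => [u v|u v|x y]; rewrite ?tractD ?tlactD ?tractD//.
by rewrite tract_tens !tlact_tens tract_tens.
Qed.

End Tensor.

Section SimpleDecomposition.
Variables (k : fieldType) (Q : algType k).

Definition simple_ideal (I : set Q) : Prop :=
  [/\ two_sided_ideal I, exists2 x, I x & x <> 0 &
      forall J, two_sided_ideal J -> J `<=` I -> J = [set 0] \/ J = I].

Record simple_decomposition := SimpleDecomposition {
  vertex : finType;
  simple_block : vertex -> set Q;
  simple_blockP : forall i, simple_ideal (simple_block i);
  simple_block_sum : forall x, exists2 f : vertex -> Q,
    (forall i, simple_block i (f i)) & x = \sum_i f i;
  simple_block_direct : forall f : vertex -> Q,
    (forall i, simple_block i (f i)) -> \sum_i f i = 0 -> forall i, f i = 0 }.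

Variable D : simple_decomposition.

Definition block_ideal (i : vertex D) : ideal Q :=
  Ideal (let: And3 h _ _ := simple_blockP i in h).

Definition block_alg (i : vertex D) : Type := subm (ideal_submod (block_ideal i)).
HB.instance Definition _ i := GRing.Lmodule.on (block_alg i).

Section BlockAlgebra.
Variable i : vertex D.
Local Notation B := (block_alg i).

Definition block_val (x : B) : Q := val (x : subm _).
Definition Block (x : Q) (Bx : block_ideal i x) : B :=
  Subm (N := ideal_submod (block_ideal i)) Bx.

Lemma block_valP (x : B) : block_ideal i (block_val x).
Proof. exact: (submP (N := ideal_submod _)). Qed.
Lemma block_val_inj : injective block_val.
Proof. exact: val_inj. Qed.

Fact block_val_linear : linear block_val.
Proof. by move=> c x y; rewrite /block_val linearP. Qed.
HB.instance Definition _ :=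
  GRing.isLinear.Build k B Q _ block_val block_val_linear.

Definition block_mul (x y : B) : B := Block (idealMl (block_val x) (block_valP y)).

Definition unit_component : Q := projT1 (cid2 (simple_block_sum D 1)) i.

Lemma unit_componentP : block_ideal i unit_component.
Proof. by rewrite /unit_component; case: cid2 => f /= Bf _; apply: Bf. Qed.

(* The identity of the block is the component of 1 in it. *)
Definition block_one : B := Block unit_componentP.

Lemma block_sum_uniq (f g : vertex D -> Q) :
  (forall j, simple_block j (f j)) -> (forall j, simple_block j (g j)) ->
  \sum_j f j = \sum_j g j -> forall j, f j = g j.
Proof.
move=> Bf Bg efg j; apply: subr0_eq.
apply: (simple_block_direct (f := fun j => f j - g j)) => [l|].
  by apply: (submodB (N := ideal_submod (block_ideal l))); [apply: Bf|apply: Bg].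
by rewrite sumrB efg subrr.
Qed.

Lemma unit_component_mul x : block_ideal i x ->
  unit_component * x = x /\ x * unit_component = x.
Proof.
move=> Bx; pose d j := if j == i then x else 0.
have Bd j : simple_block j (d j).
  by rewrite /d; case: eqP => [->//|_]; exact: (ideal0 (block_ideal j)).
have sd : \sum_j d j = x by rewrite /d -big_mkcond big_pred1_eq.
have dE : d i = x by rewrite /d eqxx.
rewrite /unit_component; case: cid2 => f /= Bf e1.
split; rewrite -[RHS]dE.
  apply: (block_sum_uniq (f := fun j => f j * x)) => // [j|].
    exact: (@idealMr _ _ (block_ideal j) _ x (Bf j)).
  by rewrite sd -mulr_suml -e1 mul1r.
apply: (block_sum_uniq (f := fun j => x * f j)) => // [j|].
  exact: (@idealMl _ _ (block_ideal j) x _ (Bf j)).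
by rewrite sd -mulr_sumr -e1 mulr1.
Qed.

Fact block_mulA : associative block_mul.
Proof. by move=> x y z; apply: block_val_inj; exact: mulrA. Qed.
Fact block_mul1l : left_id block_one block_mul.
Proof.
by move=> x; apply: block_val_inj; case: (unit_component_mul (block_valP x)).
Qed.
Fact block_mul1r : right_id block_one block_mul.
Proof.
by move=> x; apply: block_val_inj; case: (unit_component_mul (block_valP x)).
Qed.
Fact block_mulDl : left_distributive block_mul +%R.
Proof. by move=> x y z; apply: block_val_inj; exact: mulrDl. Qed.
Fact block_mulDr : right_distributive block_mul +%R.
Proof. by move=> x y z; apply: block_val_inj; exact: mulrDr. Qed.
Fact block_one_neq0 : block_one != 0.
Proof.
have [_ [x Bx x0] _] := simple_blockP i; apply/eqP => /(congr1 block_val) e0.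
have [e _] := unit_component_mul Bx.
by apply: x0; rewrite -e -[unit_component]/(block_val block_one) e0 mul0r.
Qed.
HB.instance Definition _ := GRing.Zmodule_isNzRing.Build B
  block_mulA block_mul1l block_mul1r block_mulDl block_mulDr block_one_neq0.

Fact block_scaleAl (c : k) (x y : B) : c *: (x * y) = (c *: x) * y.
Proof. by apply: block_val_inj; exact: scalerAl. Qed.
HB.instance Definition _ := GRing.Lmodule_isLalgebra.Build k B block_scaleAl.
Fact block_scaleAr (c : k) (x y : B) : c *: (x * y) = x * (c *: y).
Proof. by apply: block_val_inj; exact: scalerAr. Qed.
HB.instance Definition _ := GRing.Lalgebra_isAlgebra.Build k B block_scaleAr.

End BlockAlgebra.

Lemma vertex_inhabited : exists i : vertex D, true.
Proof.
apply: contrapT => nD; have [f _ e1] := simple_block_sum D 1.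
by move/eqP: e1; rewrite big1 ?oner_eq0// => i _; case: nD; exists i.
Qed.

Definition blocks : Type := dprod (fun i : vertex D => block_alg i).
HB.instance Definition _ := GRing.Lmodule.on blocks.

Definition blocks_mul (f g : blocks) : blocks := fun i => f i * g i.
Definition blocks_one : blocks := fun i => 1.

Fact blocks_mulA : associative blocks_mul.
Proof. by move=> f g h; apply: dprodP => i; exact: mulrA. Qed.
Fact blocks_mul1l : left_id blocks_one blocks_mul.
Proof. by move=> f; apply: dprodP => i; exact: mul1r. Qed.
Fact blocks_mul1r : right_id blocks_one blocks_mul.
Proof. by move=> f; apply: dprodP => i; exact: mulr1. Qed.
Fact blocks_mulDl : left_distributive blocks_mul +%R.
Proof. by move=> f g h; apply: dprodP => i; exact: mulrDl. Qed.
Fact blocks_mulDr : right_distributive blocks_mul +%R.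
Proof. by move=> f g h; apply: dprodP => i; exact: mulrDr. Qed.
Fact blocks_one_neq0 : blocks_one != 0.
Proof.
have [i _] := vertex_inhabited; apply/eqP => /(congr1 (fun f : blocks => f i)).
by move/eqP; rewrite oner_eq0.
Qed.
HB.instance Definition _ := GRing.Zmodule_isNzRing.Build blocks
  blocks_mulA blocks_mul1l blocks_mul1r blocks_mulDl blocks_mulDr blocks_one_neq0.

Fact blocks_scaleAl (c : k) (x y : blocks) : c *: (x * y) = (c *: x) * y.
Proof. by apply: dprodP => i; exact: scalerAl. Qed.
HB.instance Definition _ := GRing.Lmodule_isLalgebra.Build k blocks blocks_scaleAl.
Fact blocks_scaleAr (c : k) (x y : blocks) : c *: (x * y) = x * (c *: y).
Proof. by apply: dprodP => i; exact: scalerAr. Qed.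
HB.instance Definition _ := GRing.Lalgebra_isAlgebra.Build k blocks blocks_scaleAr.

Definition blocks_proj (i : vertex D) (f : blocks) : block_alg i := f i.
Fact blocks_proj_linear i : linear (blocks_proj i).
Proof. by []. Qed.
HB.instance Definition _ i := GRing.isLinear.Build k blocks (block_alg i) _
  (blocks_proj i) (blocks_proj_linear i).
Fact blocks_proj_monoid_morphism i : monoid_morphism (blocks_proj i).
Proof. by []. Qed.
HB.instance Definition _ i := GRing.isMonoidMorphism.Build blocks (block_alg i)
  (blocks_proj i) (blocks_proj_monoid_morphism i).

End SimpleDecomposition.

Section RadicalLayer.
Variables (k : fieldType) (A : algType k).
Local Notation Q := (quotalg (jrad A)).
Local Notation r := (ideal_submod (jrad A)).

Lemma idealMP (I J : set A) x y : I x -> J y -> idealM I J (x * y).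
Proof. by move=> Ix Jy N; apply; exists x, y. Qed.

Lemma idealM_Ml (I J : set A) a x : left_ideal I -> idealM I J x ->
  idealM I J (a * x).
Proof.
move=> lI IJx; pose N : submod A := @Submod k A (fun z => idealM I J (a * z))
  (eq_ind_r _ (submod0 (span _)) (mulr0 a))
  (fun y z Ny Nz => eq_ind_r _ (submodD (s := span _) Ny Nz) (mulrDr a y z))
  (fun c z Nz => eq_ind_r _ (submodZ (s := span _) c Nz) (esym (scalerAr c a z))).
apply: (IJx N) => _ [u [v [Iu Jv ->]]] /=; rewrite mulrA; apply: idealMP => //.
by case: lI => _ _; apply.
Qed.

Lemma idealM_Mr (I : set A) (J : ideal A) x a : idealM I J x ->
  idealM I J (x * a).
Proof.
move=> IJx; pose N : submod A := @Submod k A (fun z => idealM I J (z * a))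
  (eq_ind_r _ (submod0 (span _)) (mul0r a))
  (fun y z Ny Nz => eq_ind_r _ (submodD (s := span _) Ny Nz) (mulrDl y z a))
  (fun c z Nz => eq_ind_r _ (submodZ (s := span _) c Nz) (esym (scalerAl c z a))).
apply: (IJx N) => _ [u [v [Iu Jv ->]]] /=; rewrite -mulrA; apply: idealMP => //.
exact: idealMr.
Qed.

Fact rad_square0 : idealM (jrad A) (jrad A) (val (0 : subm r)).
Proof. exact: (submod0 (span _)). Qed.
Fact rad_squareD (x y : subm r) : idealM (jrad A) (jrad A) (val x) ->
  idealM (jrad A) (jrad A) (val y) -> idealM (jrad A) (jrad A) (val (x + y)).
Proof. by rewrite linearD; apply: (submodD (s := span _)). Qed.
Fact rad_squareZ c (x : subm r) : idealM (jrad A) (jrad A) (val x) ->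
  idealM (jrad A) (jrad A) (val (c *: x)).
Proof. by rewrite linearZ; apply: (submodZ (s := span _)). Qed.

Definition rad_square : submod (subm r) :=
  @Submod k (subm r) (fun x => idealM (jrad A) (jrad A) (val x))
    rad_square0 rad_squareD rad_squareZ.

Local Notation L := (lquot rad_square).
Local Notation pi := (qpi rad_square).

Definition rad_lmul (a : A) (x : subm r) : subm r :=
  Subm (N := r) (idealMl a (submP x)).
Definition rad_rmul (x : subm r) (a : A) : subm r :=
  Subm (N := r) (idealMr a (submP x)).

Definition layer_lact (q : Q) (x : L) : L := pi (rad_lmul (quotrepr q) (qrepr x)).
Definition layer_ract (x : L) (q : Q) : L := pi (rad_rmul (qrepr x) (quotrepr q)).

Lemma layer_lactE a x : layer_lact (quotpi (jrad A) a) (pi x) = pi (rad_lmul a x).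
Proof.
apply/qpi_eq; set a' := quotrepr _; set x' := qrepr _.
change (idealM (jrad A) (jrad A) (a' * val x' - a * val x)).
have -> : a' * val x' - a * val x = (a' - a) * val x' + a * (val x' - val x).
  by rewrite mulrBl mulrBr addrA subrK.
apply: (submodD (s := span _)).
  apply: idealMP; last exact: (submP x').
  by apply/quotpi_eq; rewrite quotreprK.
apply: idealM_Ml; first by case: (ideal_two_sided (jrad A)).
exact: (qpi_reprB rad_square x).
Qed.

Lemma layer_ractE a x : layer_ract (pi x) (quotpi (jrad A) a) = pi (rad_rmul x a).
Proof.
apply/qpi_eq; set a' := quotrepr _; set x' := qrepr _.
change (idealM (jrad A) (jrad A) (val x' * a' - val x * a)).
have -> : val x' * a' - val x * a = val x' * (a' - a) + (val x' - val x) * a.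
  by rewrite mulrBl mulrBr addrA subrK.
apply: (submodD (s := span _)).
  apply: idealMP; first exact: (submP x').
  by apply/quotpi_eq; rewrite quotreprK.
apply: idealM_Mr.
exact: (qpi_reprB rad_square x).
Qed.

Program Definition rad_layer : bimod Q Q :=
  @Bimod k Q Q L layer_lact layer_ract _ _ _ _ _ _ _ _ _ _ _ _ _.
Next Obligation.
rewrite -(qreprK x) -[1](rmorph1 (quotpi (jrad A))) layer_lactE.
by congr qpi; apply: val_inj; rewrite /= mul1r.
Qed.
Next Obligation.
rewrite -(quotreprK a) -(quotreprK b) -(qreprK x).
move: (quotrepr a) (quotrepr b) (qrepr x) => {}a {}b {}x.
rewrite -rmorphM (layer_lactE b) !layer_lactE.
by congr qpi; apply: val_inj; rewrite /= mulrA.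
Qed.
Next Obligation.
rewrite -(quotreprK a) -(quotreprK b) -(qreprK x) -rmorphD !layer_lactE -qpiD.
by congr qpi; apply: val_inj; rewrite /= mulrDl.
Qed.
Next Obligation.
rewrite -(quotreprK a) -(qreprK x) -(qreprK y) -qpiD !layer_lactE -qpiD.
by congr qpi; apply: val_inj; rewrite /= mulrDr.
Qed.
Next Obligation.
rewrite -(quotreprK a) -(qreprK x) -[c *: quotpi _ _]linearZ !layer_lactE.
rewrite -[RHS]linearZ.
by congr qpi; apply: val_inj; rewrite /= scalerAl.
Qed.
Next Obligation.
rewrite -(quotreprK a) -(qreprK x) -[c *: pi _]linearZ !layer_lactE.
rewrite -[RHS]linearZ.
by congr qpi; apply: val_inj; rewrite /= scalerAr.
Qed.
Next Obligation.
rewrite -(qreprK x) -[1](rmorph1 (quotpi (jrad A))) layer_ractE.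
by congr qpi; apply: val_inj; rewrite /= mulr1.
Qed.
Next Obligation.
rewrite -(quotreprK a) -(quotreprK b) -(qreprK x).
move: (quotrepr a) (quotrepr b) (qrepr x) => {}a {}b {}x.
rewrite -rmorphM (layer_ractE a) !layer_ractE.
by congr qpi; apply: val_inj; rewrite /= mulrA.
Qed.
Next Obligation.
rewrite -(quotreprK b) -(qreprK x) -(qreprK y) -qpiD !layer_ractE -qpiD.
by congr qpi; apply: val_inj; rewrite /= mulrDl.
Qed.
Next Obligation.
rewrite -(quotreprK a) -(quotreprK b) -(qreprK x) -rmorphD !layer_ractE -qpiD.
by congr qpi; apply: val_inj; rewrite /= mulrDr.
Qed.
Next Obligation.
rewrite -(quotreprK b) -(qreprK x) -[c *: pi _]linearZ !layer_ractE.
rewrite -[RHS]linearZ.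
by congr qpi; apply: val_inj; rewrite /= scalerAl.
Qed.
Next Obligation.
rewrite -(quotreprK b) -(qreprK x) -[c *: quotpi _ _]linearZ !layer_ractE.
rewrite -[RHS]linearZ.
by congr qpi; apply: val_inj; rewrite /= scalerAr.
Qed.
Next Obligation.
rewrite -(quotreprK a) -(quotreprK b) -(qreprK x).
move: (quotrepr a) (quotrepr b) (qrepr x) => {}a {}b {}x.
rewrite (layer_lactE a x) (layer_ractE b x) layer_lactE layer_ractE.
by congr qpi; apply: val_inj; rewrite /= mulrA.
Qed.

End RadicalLayer.

Section NaturalQuiver.
Variables (k : fieldType) (A : algType k).
Local Notation Q := (quotalg (jrad A)).
Variable D : simple_decomposition Q.
Local Notation L := (rad_layer A).

Definition generated_by (j i : vertex D) (n : nat) : Prop :=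
  exists g : 'I_n -> L,
    bimod_gen (simple_block j) (simple_block i) (range g) =
    sandwich (simple_block j) L (simple_block i).

(* The default value 0 is used only when A_j (r/r^2) A_i is not finitely
   generated, which does not happen when A is left Artinian. *)
Definition arrow_number (i j : vertex D) : nat :=
  if pselect (exists n, `[< generated_by j i n >]) is left fg then ex_minn fg else 0.

(* The free bimodule of rank one is the tensor product over k of A_j and A_i:
   as a module over the tensor product of A_j and A_i^op it is the regular one. *)
Definition arrow_bimod (i j : vertex D) : bimod (block_alg j) (block_alg i) :=
  prod_bimod (fun _ : 'I_(arrow_number i j) =>
    tensor (lreg_bimod (block_alg j)) (rreg_bimod (block_alg i))).

Definition path_bimod : bimod (blocks D) (blocks D) :=
  prod_bimod (fun e : vertex D * vertex D =>
    restr_bimod (blocks_proj (D := D) e.2) (blocks_proj (D := D) e.1)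
      (arrow_bimod e.1 e.2)).

End NaturalQuiver.

Section TensorAlgebra.
Variables (k : fieldType) (R : algType k) (M : bimod R R).

Fixpoint tensor_power (n : nat) : bimod R R :=
  if n is m.+1 then tensor M (tensor_power m) else reg_bimod R.

Local Notation P := (dprod (fun n => bcar (tensor_power n))).

Definition shift (x : M) (z : P) : P :=
  fun n => if n is m.+1 then tens x (z m) else 0.

(* Left multiplication by a homogeneous element, i.e. concatenation of tensors:
   (tens x y) . z = tens x (y . z), with the left action of R in degree 0. *)
Fixpoint concat (m : nat) : tensor_power m -> P -> P :=
  match m with
  | 0 => fun a z n => lact (a : R) (z n)
  | m'.+1 => fun u z => tlift (fun x y => shift x (concat y z)) u
  end.

(* Multiplication on the product of all tensor powers: the component of degree
   n of the concatenation with an element of degree m vanishes if n < m. *)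
Definition series_mul (t z : P) : P := fun n => \sum_(m < n.+1) concat (t m) z n.

Definition series_one : P := fun n => if n is 0 then 1 : R else 0.

Definition lactP (s : R) (z : P) : P := fun n => lact s (z n).

Lemma lact0r (R' S' : algType k) (B : bimod R' S') a : lact a (0 : B) = 0.
Proof. by rewrite -{1}(scale0r 0) lactZr scale0r. Qed.
Lemma lact0l (R' S' : algType k) (B : bimod R' S') (x : B) : lact 0 x = 0.
Proof. by rewrite -{1}(scale0r 0) lactZl scale0r. Qed.
Lemma tens0r (R' S' T' : algType k) (X : bimod R' S') (Y : bimod S' T') (x : X) :
  tens x (0 : Y) = 0.
Proof. by rewrite -{1}(scale0r 0) tensZr scale0r. Qed.

Lemma shiftDl x x' z : shift (x + x') z = shift x z + shift x' z.
Proof. by apply: dprodP => -[|n]; rewrite dprodD /= ?addr0// tensDl. Qed.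
Lemma shiftDr x z z' : shift x (z + z') = shift x z + shift x z'.
Proof. by apply: dprodP => -[|n]; rewrite dprodD /= ?addr0// tensDr. Qed.
Lemma shiftZl c x z : shift (c *: x) z = c *: shift x z.
Proof. by apply: dprodP => -[|n]; rewrite dprodZ /= ?scaler0// tensZl. Qed.
Lemma shiftZr c x z : shift x (c *: z) = c *: shift x z.
Proof. by apply: dprodP => -[|n]; rewrite dprodZ /= ?scaler0// tensZr. Qed.
Lemma shiftA x s z : shift (ract x s) z = shift x (lactP s z).
Proof. by apply: dprodP => -[|n] //=; rewrite tensA. Qed.

Lemma concat_props m :
  [/\ forall u v z, concat (u + v : tensor_power m) z = concat u z + concat v z,
      forall c u z, concat (c *: u : tensor_power m) z = c *: concat u z &
      forall s u z, concat (lact s u : tensor_power m) z = lactP s (concat u z)].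
Proof.
elim: m => [|m [IHD IHZ IHA]].
  split=> [a b z|c a z|s a z]; apply: dprodP => n /=.
  - exact: lactDl.
  - exact: lactZl.
  - exact: lactA.
have bal z : balanced (fun x (y : tensor_power m) => shift x (concat y z)).
  split=> [x x' y|x y y'|c x y|x s y].
  - exact: shiftDl.
  - by rewrite IHD shiftDr.
  - exact: shiftZl.
  - by rewrite IHA shiftA.
split=> [u v z|c u z|s u z].
- exact: tliftD.
- exact: tliftZ.
rewrite /=; move: u; apply: tensor_ext => [u v|u v|x y].
- by rewrite tlactD tliftD.
- by rewrite tliftD//; apply: dprodP => n; exact: lactDr.
rewrite tlact_tens !tlift_tens//; apply: dprodP => -[|n] /=.
  by rewrite /lactP lact0r.
by rewrite /lactP /= tlact_tens.
Qed.

Lemma concatDl m (u v : tensor_power m) z : concat (u + v) z = concat u z + concat v z.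
Proof. by case: (concat_props m). Qed.
Lemma concatZl m c (u : tensor_power m) z : concat (c *: u) z = c *: concat u z.
Proof. by case: (concat_props m). Qed.
Lemma concat_lact m s (u : tensor_power m) z : concat (lact s u) z = lactP s (concat u z).
Proof. by case: (concat_props m). Qed.
Lemma concat0l m z : concat (0 : tensor_power m) z = 0.
Proof. by rewrite -(scale0r 0) concatZl scale0r. Qed.

Lemma concat_balanced m z :
  balanced (fun x (y : tensor_power m) => shift x (concat y z)).
Proof.
split=> [x x' y|x y y'|c x y|x s y].
- exact: shiftDl.
- by rewrite concatDl shiftDr.
- exact: shiftZl.
- by rewrite concat_lact shiftA.
Qed.

Lemma concat_tens m x (y : tensor_power m) z :
  concat (tens x y : tensor_power m.+1) z = shift x (concat y z).
Proof. by rewrite /= tlift_tens//; exact: concat_balanced. Qed.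

Lemma tensor_powerS_ind m (Pr : tensor_power m.+1 -> Prop) :
  Pr 0 -> (forall u v, Pr u -> Pr v -> Pr (u + v)) ->
  (forall x (y : tensor_power m), Pr (tens x y)) -> forall u, Pr u.
Proof. exact: tensor_ind. Qed.

Lemma concatDr m (u : tensor_power m) z z' : concat u (z + z') = concat u z + concat u z'.
Proof.
elim: m u => [|m IH] u.
  by apply: dprodP => n /=; exact: lactDr.
elim/tensor_powerS_ind: u => [|u v IHu IHv|x y].
- by rewrite !concat0l addr0.
- by rewrite !concatDl IHu IHv addrACA.
- by rewrite !concat_tens IH shiftDr.
Qed.

Lemma concatZr m (u : tensor_power m) c z : concat u (c *: z) = c *: concat u z.
Proof.
elim: m u => [|m IH] u.
  by apply: dprodP => n /=; exact: lactZr.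
elim/tensor_powerS_ind: u => [|u v IHu IHv|x y].
- by rewrite !concat0l scaler0.
- by rewrite !concatDl IHu IHv scalerDr.
- by rewrite !concat_tens IH shiftZr.
Qed.

(* Concatenation raises degrees by m. *)
Lemma concat_supp m N (u : tensor_power m) z :
  (forall n, (N <= n)%N -> z n = 0) ->
  forall n, (m + N <= n)%N -> concat u z n = 0.
Proof.
move=> zN; elim: m u => [|m IH] u n le_n.
  by rewrite /= zN// lact0r.
elim/tensor_powerS_ind: u => [|u v IHu IHv|x y].
- by rewrite concat0l.
- by rewrite concatDl dprodD IHu IHv addr0.
- by rewrite concat_tens; case: n le_n => [|n] //= le_n; rewrite IH// tens0r.
Qed.

Lemma concat_low m (u : tensor_power m) z n : (n < m)%N -> concat u z n = 0.
Proof.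
elim: m u n => [|m IH] u n // lt_n.
elim/tensor_powerS_ind: u => [|u v IHu IHv|x y].
- by rewrite concat0l.
- by rewrite concatDl dprodD IHu IHv addr0.
- by rewrite concat_tens; case: n lt_n => [|n] //= lt_n; rewrite IH// tens0r.
Qed.

Lemma series_mulE N (t z : P) n : (n < N)%N ->
  series_mul t z n = \sum_(m < N) concat (t m) z n.
Proof.
move=> ltnN; rewrite /series_mul (big_ord_widen N (fun m => concat (t m) z n))//.
rewrite [RHS](bigID (fun m : 'I_N => (m < n.+1)%N)) /= [X in _ + X]big1 ?addr0//.
by move=> m; rewrite -leqNgt => /concat_low ->.
Qed.

Fact series_mulDl : left_distributive series_mul +%R.
Proof.
move=> t u z; apply: dprodP => n; rewrite dprodD -big_split.
by apply: eq_bigr => m _; rewrite dprodD concatDl dprodD.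
Qed.
Fact series_mulDr : right_distributive series_mul +%R.
Proof.
move=> t u z; apply: dprodP => n; rewrite dprodD -big_split.
by apply: eq_bigr => m _; rewrite concatDr dprodD.
Qed.
Fact series_mulZl c t z : c *: series_mul t z = series_mul (c *: t) z.
Proof.
apply: dprodP => n; rewrite dprodZ scaler_sumr.
by apply: eq_bigr => m _; rewrite dprodZ concatZl dprodZ.
Qed.
Fact series_mulZr c t z : c *: series_mul t z = series_mul t (c *: z).
Proof.
apply: dprodP => n; rewrite dprodZ scaler_sumr.
by apply: eq_bigr => m _; rewrite concatZr dprodZ.
Qed.

Fact series_mul1l : left_id series_one series_mul.
Proof.
move=> z; apply: dprodP => n; rewrite /series_mul big_ord_recl big1 ?addr0.
  by rewrite /= lact1.
move=> m _; have -> : series_one (fintype.lift ord0 m) = 0 by [].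
by rewrite concat0l.
Qed.

Lemma concat1 m (u : tensor_power m) : concat u series_one m = u /\
  forall n, n != m -> concat u series_one n = 0.
Proof.
elim: m u => [|m IH] u.
  split=> [|[|n] // _]; first exact: mulr1.
  exact: lact0r.
elim/tensor_powerS_ind: u => [|u v [IHu IHu0] [IHv IHv0]|x y].
- by rewrite concat0l.
- rewrite concatDl; split=> [|n nm]; first by rewrite dprodD IHu IHv.
  by rewrite dprodD IHu0// IHv0// addr0.
- rewrite concat_tens; have [e e0] := IH y; split=> [|[|n] nm] //=.
    by rewrite e.
  by rewrite e0// tens0r.
Qed.

Fact series_mul1r : right_id series_one series_mul.
Proof.
move=> t; apply: dprodP => n; rewrite /series_mul big_ord_recr big1 /=.
  by rewrite add0r (concat1 (t n)).1.
by move=> m _; rewrite (concat1 (t m)).2// gtn_eqF.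
Qed.

Lemma series_mul_shift x z w : series_mul (shift x z) w = shift x (series_mul z w).
Proof.
apply: dprodP => n; rewrite /series_mul big_ord_recl /= lact0l add0r.
case: n => [|n]; first by rewrite big_ord0.
transitivity (\sum_(m < n.+1) shift x (concat (z m) w) n.+1).
  by apply: eq_bigr => m _; rewrite -concat_tens.
rewrite -[RHS]/(tens x (\sum_(m < n.+1) concat (z m) w n)) /=.
exact/esym/(big_morph _ (tensDr x) (tens0r _ x)).
Qed.

Lemma series_mul_concat m (u : tensor_power m) z w :
  series_mul (concat u z) w = concat u (series_mul z w).
Proof.
elim: m u => [|m IH] u.
  apply: dprodP => n /=.
  transitivity (\sum_(p < n.+1) lact (u : R) (concat (z p) w n)).
    by apply: eq_bigr => p _; rewrite concat_lact.
  exact/esym/(big_morph _ (@lactDr _ _ _ (tensor_power n) u) (lact0r _ u)).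
elim/tensor_powerS_ind: u => [|u v IHu IHv|x y].
- rewrite !concat0l; apply: dprodP => n; apply: big1 => p _.
  by rewrite concat0l.
- by rewrite !concatDl series_mulDl IHu IHv.
- by rewrite !concat_tens series_mul_shift IH.
Qed.

Fact series_mulA : associative series_mul.
Proof.
move=> t u w; apply: dprodP => n.
rewrite [LHS]/series_mul.
under eq_bigr => m _ do rewrite -series_mul_concat /series_mul.
rewrite exchange_big /= [RHS]/series_mul; apply: eq_bigr => p _.
rewrite (@series_mulE n.+1 t u p)//.
pose f (v : tensor_power p) := concat v w n.
have fD v v' : f (v + v') = f v + f v' by rewrite /f concatDl.
have f0 : f 0 = 0 by rewrite /f concat0l.
exact/esym/(big_morph f fD f0).
Qed.

(* The tensor algebra is carried by the direct sum of the tensor powers, the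
   submodule of elements of finite support in their product. *)
Definition finite_support (z : P) : Prop :=
  exists N, forall n, (N <= n)%N -> z n = 0.

Fact finite_support0 : finite_support 0.
Proof. by exists 0%N. Qed.
Fact finite_supportD y z : finite_support y -> finite_support z ->
  finite_support (y + z).
Proof.
move=> [N yN] [N' zN']; exists (maxn N N') => n; rewrite geq_max => /andP[nN nN'].
by rewrite dprodD yN// zN'// addr0.
Qed.
Fact finite_supportZ c z : finite_support z -> finite_support (c *: z).
Proof. by move=> [N zN]; exists N => n nN; rewrite dprodZ zN// scaler0. Qed.
Fact finite_support1 : finite_support series_one.
Proof. by exists 1%N => -[]. Qed.
Fact finite_supportM y z : finite_support y -> finite_support z ->
  finite_support (series_mul y z).
Proof.
move=> [N yN] [N' zN']; exists (N + N')%N => n le_n; apply: big1 => m _.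
have [leNm|ltmN] := leqP N m; first by rewrite yN// concat0l.
by apply: concat_supp zN' _ _; apply: leq_trans le_n; rewrite leq_add2r ltnW.
Qed.

Definition direct_sum : submod P :=
  Submod finite_support0 finite_supportD finite_supportZ.

Definition tensor_algebra : Type := subm direct_sum.
HB.instance Definition _ := GRing.Lmodule.on tensor_algebra.

Definition tcomp (t : tensor_algebra) (n : nat) : tensor_power n :=
  (val (t : subm direct_sum) : P) n.

Lemma tcompP (t u : tensor_algebra) : (forall n, tcomp t n = tcomp u n) -> t = u.
Proof. by move=> e; apply: val_inj; exact: dprodP. Qed.

Definition talg_mul (t u : tensor_algebra) : tensor_algebra :=
  Subm (N := direct_sum) (finite_supportM (submP t) (submP u)).
Definition talg_one : tensor_algebra := Subm (N := direct_sum) finite_support1.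

Fact talg_mulA : associative talg_mul.
Proof. by move=> t u v; apply: val_inj; exact: series_mulA. Qed.
Fact talg_mul1l : left_id talg_one talg_mul.
Proof. by move=> t; apply: val_inj; exact: series_mul1l. Qed.
Fact talg_mul1r : right_id talg_one talg_mul.
Proof. by move=> t; apply: val_inj; exact: series_mul1r. Qed.
Fact talg_mulDl : left_distributive talg_mul +%R.
Proof. by move=> t u v; apply: val_inj; exact: series_mulDl. Qed.
Fact talg_mulDr : right_distributive talg_mul +%R.
Proof. by move=> t u v; apply: val_inj; exact: series_mulDr. Qed.
Fact talg_one_neq0 : talg_one != 0.
Proof.
apply/eqP => /(congr1 (fun t => tcomp t 0)) e; have /eqP := oner_neq0 R; apply.
exact: e.
Qed.
HB.instance Definition _ := GRing.Zmodule_isNzRing.Build tensor_algebra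
  talg_mulA talg_mul1l talg_mul1r talg_mulDl talg_mulDr talg_one_neq0.

Fact talg_scaleAl (c : k) (t u : tensor_algebra) : c *: (t * u) = (c *: t) * u.
Proof. by apply: val_inj; exact: series_mulZl. Qed.
HB.instance Definition _ :=
  GRing.Lmodule_isLalgebra.Build k tensor_algebra talg_scaleAl.
Fact talg_scaleAr (c : k) (t u : tensor_algebra) : c *: (t * u) = t * (c *: u).
Proof. by apply: val_inj; exact: series_mulZr. Qed.
HB.instance Definition _ :=
  GRing.Lalgebra_isAlgebra.Build k tensor_algebra talg_scaleAr.

Definition homogeneous (d : nat) : set tensor_algebra :=
  fun t => forall n, n != d -> tcomp t n = 0.

End TensorAlgebra.

Definition gpa (k : fieldType) (A : algType k)
  (D : simple_decomposition (quotalg (jrad A))) : algType k :=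
  tensor_algebra (path_bimod D).

(* The elements of degree 1 are the virtual paths of length 1. *)
Definition gpa_ideal (k : fieldType) (A : algType k)
  (D : simple_decomposition (quotalg (jrad A))) : set (gpa D) :=
  idealgen (homogeneous (M := path_bimod D) 1).

Arguments gpa_ideal {k A} D.

Definition kernel (k : fieldType) (A B : algType k) (f : {lrmorphism A -> B}) : set A :=
  [set x | f x = 0].

(* Main.v *)
(* The splitting rho and lifts w in r of bimodule generators of the blocks of r/r^2
   determine a homomorphism from the tensor algebra to A which is rho in degree 0
   and maps x (x) y in the copy of A_j (x) A_i indexed by an arrow to
   rho x * w * rho y. The paths of length 1 hit r modulo r^2, so products of them
   hit r^n modulo r^(n+1); since r is nilpotent, the homomorphism is onto. It maps
   J into r, and modulo r it is the isomorphism from the product of the blocks to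
   A/r on degree 0, which gives both inclusions. The blocks of r/r^2 are finitely
   generated because r/r^2 is spanned by elements generating simple submodules,
   and an infinite independent sequence of these would contradict the descending
   chain condition. *)
From HB Require Import structures.
Require Import Defs.
From mathcomp Require Import all_boot all_algebra.
From mathcomp Require Import boolp classical_sets.

Set Implicit Arguments.
Unset Strict Implicit.
Unset Printing Implicit Defensive.

Import GRing.Theory.
Local Open Scope classical_set_scope.
Local Open Scope ring_scope.

(** * Submodules and linear images of spans *)

Definition zero_submod (k : fieldType) (V : lmodType k) : submod V :=
  @Submod k V (fun u => u = 0) (erefl 0)
    (fun u v u0 v0 => etrans (f_equal2 _ u0 v0) (addr0 0))
    (fun c u u0 => etrans (f_equal _ u0) (scaler0 V c)).

Lemma ract0r (k : fieldType) (R S : algType k) (B : bimod R S) (x : B) :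
  ract x 0 = 0.
Proof. by rewrite -{1}(scale0r 0) ractZr scale0r. Qed.

(** The preimage of [N] under [f] is a submodule, so it contains the span of [X] once it contains
    [X]. Taking [zero_submod] for [N] shows that a linear map vanishes on a span. *)
Lemma spanm_map (k : fieldType) (V W : lmodType k) (f : V -> W) (X : set V)
    (N : submod W) :
  (forall x y, f (x + y) = f x + f y) -> (forall c x, f (c *: x) = c *: f x) ->
  (forall x, X x -> N (f x)) -> forall x, spanm X x -> N (f x).
Proof.
move=> fD fZ fX x Xx; have f0 : f 0 = 0 by rewrite -(scale0r 0) fZ scale0r.
exact: (Xx (@Submod k V (fun x => N (f x)) (eq_ind_r N (submod0 N) f0)
  (fun u v Nu Nv => eq_ind_r N (submodD Nu Nv) (fD u v))
  (fun c u Nu => eq_ind_r N (submodZ c Nu) (fZ c u)))).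
Qed.

(** * Left Artinian algebras: nilpotency of r and finite generation of r modulo r^2 *)

Section LeftArtinian.
Variables (k : fieldType) (A : algType k).
Local Notation r := (ideal_set (jrad A)).

Lemma left_idealB (I : set A) x y : left_ideal I -> I x -> I y -> I (x - y).
Proof.
by move=> [_ ID IM] Ix Iy; rewrite -[y]mul1r -mulNr; apply/ID => //; apply: IM.
Qed.

Lemma left_ideal_sub_maximal (K : set A) : left_ideal K -> ~ K 1 ->
  exists2 I, maximal_left_ideal I & K `<=` I.
Proof.
move=> lK nK1.
(* The nonemptiness premise makes the empty set satisfy [P], since [Zorn_bigcup] also asks for the
   union of the empty chain. *)
pose P := fun I : set A => (exists x, I x) -> [/\ left_ideal I, K `<=` I & ~ I 1].
have [F FP Ftot|I [PI maxI]] := @Zorn_bigcup A P.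
  move=> [x0 [X0 FX0 X0x0]].
  have FL X x : F X -> X x -> [/\ left_ideal X, K `<=` X & ~ X 1].
    by move=> /FP PX Xx; apply: PX; exists x.
  split; last 1 first.
  - by move=> [X FX X1]; have [_ _] := FL _ _ FX X1; apply.
  - split=> [|x y [X FX Xx] [Y FY Yy]|a x [X FX Xx]].
    + by exists X0 => //; have [[]] := FL _ _ FX0 X0x0.
    + have [[_ XD _] _ _] := FL _ _ FX Xx; have [[_ YD _] _ _] := FL _ _ FY Yy.
      have [sXY|sYX] := Ftot _ _ FX FY.
        by exists Y => //; apply: YD => //; apply: sXY.
      by exists X => //; apply: XD => //; apply: sYX.
    + by exists X => //; have [[_ _ XM] _ _] := FL _ _ FX Xx; apply: XM.
  - by move=> x Kx; exists X0 => //; have [_ + _] := FL _ _ FX0 X0x0; apply.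
have PK : P K by move=> _; split.
have I0 : exists x, I x.
  apply: contrapT => nI; apply: (maxI _ _ PK); split=> [x Ix|sKI].
    by case: nI; exists x.
  by apply: nI; exists 0; apply: sKI; case: lK.
have [lI sKI nI1] := PI I0.
exists I => //; split=> // J lJ sIJ nJ1; apply: contrapT => nJI.
apply: (maxI J); last by move=> _; split=> //; exact: subset_trans sIJ.
by split=> // sJI; apply: nJI; apply/seteqP.
Qed.

(** A form of Nakayama's lemma: if [x] is nonzero, its annihilator is proper and lies in a maximal
    left ideal. That ideal contains both [1 - c] and [c], hence 1. *)
Lemma jacobson_fixed0 c x : r c -> c * x = x -> x = 0.
Proof.
move=> rc cx; apply: contrapT => x0.
have lK : left_ideal [set a | a * x = 0].
  split=> [|a b /= ax bx|a b /= bx]; first by rewrite /= mul0r.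
    by rewrite mulrDl ax bx addr0.
  by rewrite -mulrA bx mulr0.
have [|I mI sKI] := left_ideal_sub_maximal lK; first by rewrite /= mul1r.
have [[_ ID _] nI1 _] := mI; apply: nI1; rewrite -(subrK c 1); apply: ID.
  by apply: sKI; rewrite /= mulrBl mul1r cx subrr.
exact: (rc _ mI).
Qed.

(** Without a minimal element, choice gives a strictly decreasing sequence of left ideals satisfying
    [P]. *)
Lemma left_artinian_minimal (P : set A -> Prop) : left_artinian A ->
  (exists2 I, left_ideal I & P I) ->
  exists I, [/\ left_ideal I, P I &
    forall J, left_ideal J -> P J -> J `<=` I -> J = I].
Proof.
move=> artA [I0 lI0 PI0]; apply: contrapT => nmin.
pose T := {I : set A | left_ideal I /\ P I}.
have step (I : T) : exists J : T, sval J `<=` sval I /\ sval J <> sval I.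
  case: I => I [lI PI] /=; apply: contrapT => nJ; apply: nmin.
  exists I; split=> // J lJ PJ sJI; apply: contrapT => nJI.
  by apply: nJ; exists (exist _ J (conj lJ PJ)).
have [F FP] := choice step.
pose I n : T := iter n F (exist _ I0 (conj lI0 PI0)).
have [|n|n In] := artA (fun n => sval (I n)).
- by move=> n; case: (svalP (I n)).
- by have [] := FP (I n).
by have [_] := FP (I n); apply; apply: (In n.+1).
Qed.

Lemma idealM_map (V : lmodType k) (f : A -> V) (N : submod V) (I J : set A) :
  (forall x y, f (x + y) = f x + f y) -> (forall c x, f (c *: x) = c *: f x) ->
  (forall x y, I x -> J y -> N (f (x * y))) -> forall z, idealM I J z -> N (f z).
Proof.
move=> fD fZ IJN; apply: spanm_map => // _ [x [y [Ix Jy ->]]].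
exact: IJN.
Qed.

Lemma idealM_ind (I J : set A) (N : submod A) :
  (forall x y, I x -> J y -> N (x * y)) -> idealM I J `<=` N.
Proof. exact: (idealM_map (f := id)). Qed.

Lemma idealMA (I J K : set A) : idealM (idealM I J) K = idealM I (idealM J K).
Proof.
apply/seteqP; split; apply: (idealM_ind (N := Defs.span _)).
  move=> x z IJx Kz; apply: (idealM_map (f := fun u => u * z) (N := Defs.span _) _ _ _ IJx).
  - by move=> u v; rewrite mulrDl.
  - by move=> c u; rewrite scalerAl.
  - by move=> u v Iu Jv; rewrite -mulrA; apply: idealMP => //; apply: idealMP.
move=> x z Ix JKz; apply: (idealM_map (f := fun u => x * u) (N := Defs.span _) _ _ _ JKz).
- by move=> u v; rewrite mulrDr.
- by move=> c u; rewrite scalerAr.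
- by move=> u v Ju Kv; rewrite mulrA; apply: idealMP => //; apply: idealMP.
Qed.

Lemma idealX_two_sided (I : ideal A) n : two_sided_ideal (idealX I n).
Proof.
case: n => [|n]; first by [].
elim: n => [|n IH]; split.
- split=> [|x y|a x].
  + exact: (submod0 (Defs.span _)).
  + exact: (submodD (s := Defs.span _)).
  + by apply: idealM_Ml; case: (ideal_two_sided I).
- by move=> x a; apply: (@idealM_Mr _ _ _ (@Ideal k A setT _)).
- split=> [|x y|a x].
  + exact: (submod0 (Defs.span _)).
  + exact: (submodD (s := Defs.span _)).
  + by apply: idealM_Ml; case: (ideal_two_sided I).
- by move=> x a; apply: (@idealM_Mr _ _ _ (Ideal IH)).
Qed.

Lemma idealX1 (I : ideal A) : idealX I 1 = I.
Proof.
apply/seteqP; split=> [|x Ix] /=.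
  by apply: (idealM_ind (N := ideal_submod I)) => x y Ix _; apply: Defs.idealMr.
by rewrite -[x]mulr1; apply: idealMP.
Qed.

(** Powers are defined by multiplying by [I] on the left; the nilpotency argument needs to split off
    a factor of [I] on the right. *)
Lemma idealXSr (I : ideal A) n : idealX I n.+1 = idealM (idealX I n) I.
Proof.
elim: n => [|n IH].
  rewrite idealX1; apply/seteqP; split=> [x Ix /=|].
    by rewrite -[x]mul1r; apply: idealMP.
  by apply: (idealM_ind (N := ideal_submod I)) => x y _ Iy; apply: Defs.idealMl.
by rewrite -[LHS]/(idealM I (idealX I n.+1)) {1}IH -idealMA.
Qed.

Lemma idealX_succ (I : ideal A) n : idealX I n.+1 `<=` idealX I n.
Proof.
apply: (idealM_ind (N := ideal_submod (Ideal (idealX_two_sided I n)))) => x y _.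
exact: (Defs.idealMl (I := Ideal (idealX_two_sided I n))).
Qed.

Lemma jacobson_nilpotent : left_artinian A -> exists n, forall x, idealX r n x -> x = 0.
Proof.
move=> artA.
have [n rn] := artA _ (fun n => (idealX_two_sided (jrad A) n).1)
  (@idealX_succ (jrad A)).
exists n => x rnx; apply: contrapT => x0.
(* A minimal A y not annihilated by r^n equals A c y for some c in r. *)
pose P (K : set A) := exists y, (exists2 a, idealX r n a & a * y <> 0) /\
  K = [set b * y | b in setT].
have lP y : left_ideal [set b * y | b in setT].
  split=> [|_ _ [b _ <-] [c _ <-]|a _ [b _ <-]].
  - by exists 0 => //; rewrite mul0r.
  - by exists (b + c) => //; rewrite mulrDl.
  - by exists (a * b) => //; rewrite mulrA.
have [|K [lK [y [[a rna ay0] ->]] minK]] := left_artinian_minimal (P := P) artA.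
  exists [set b * 1 | b in setT]; first exact: lP.
  by exists 1; split=> //; exists x => //; rewrite mulr1.
have [c [rc [b rnb bcy0]]] : exists c, r c /\ exists2 b, idealX r n b & b * (c * y) <> 0.
  apply: contrapT => nc; apply: ay0.
  (* Stability of the powers puts [a] in r^n r, so [a] is a sum of products of an element of r^n
     with an element of r. *)
  move: rna; rewrite -(rn n.+1)// idealXSr.
  apply: (idealM_map (f := fun u => u * y) (N := zero_submod A)) => [u v|d u|b c rnb rc] /=.
  - by rewrite mulrDl.
  - by rewrite scalerAl.
  apply: contrapT => bcy; apply: nc; exists c; split=> //.
  by exists b => //; rewrite mulrA.
have : [set b * (c * y) | b in setT] y.
  rewrite (minK [set b * (c * y) | b in setT]).
  - by exists 1 => //; rewrite mul1r.
  - exact: lP.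
  - by exists (c * y); split=> //; exists b.
  - by move=> _ [d _ <-]; exists (d * c) => //; rewrite mulrA.
move=> [d _ dcy]; apply: ay0; rewrite (_ : y = 0) ?mulr0//.
apply: (@jacobson_fixed0 (d * c)); last by rewrite -mulrA.
exact: (Defs.idealMl (I := jrad A)).
Qed.

(* Each A e is simple or zero modulo the radical, so that for x in r the element
   e * x generates a simple or zero submodule of r/r^2. *)
Lemma one_sum_simple : left_artinian A -> exists s : seq A,
  r (1 - \sum_(e <- s) e) /\ (forall e, e \in s ->
    exists2 I, maximal_left_ideal I & forall a, I a -> r (a * e)).
Proof.
move=> artA.
(* A left ideal [K] that is minimal among those modulo which 1 is such a sum is shown to lie in
   every maximal left ideal. *)
pose P (K : set A) := exists s : seq A, K (1 - \sum_(e <- s) e) /\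
  (forall e, e \in s -> exists2 I, maximal_left_ideal I & forall a, I a -> K (a * e)).
have [|K [lK [s [s1 sK]] minK]] := left_artinian_minimal (P := P) artA.
  by exists setT => //; exists [::].
have sKr : K `<=` r.
  (* If a maximal I does not contain K, then 1 = u + v with u in K and v in I,
     and u together with the e * v is a decomposition of 1 for K `&` I. *)
  move=> x Kx I mI; apply: contrapT => nIx.
  have [lI nI1 maxI] := mI; have [I0 ID IM] := lI; have [K0 KD KM] := lK.
  pose J : set A := fun z => exists a b, [/\ K a, I b & z = a + b].
  have lJ : left_ideal J.
    split=> [|_ _ [a [b [Ka Ib ->]]] [a' [b' [Ka' Ib' ->]]]|c _ [a [b [Ka Ib ->]]]].
    - by exists 0, 0; rewrite addr0.
    - exists (a + a'), (b + b'); rewrite addrACA.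
      by split=> //; [exact: KD|exact: ID].
    - exists (c * a), (c * b); rewrite mulrDr.
      by split=> //; [exact: KM|exact: IM].
  have [u [v [Ku Iv e1]]] : J 1.
    apply: contrapT => nJ1; apply: nIx; rewrite -(maxI J) //.
      by exists x, 0; rewrite addr0.
    by move=> y Iy; exists 0, y; rewrite add0r.
  have vE : v = 1 - u by rewrite e1 addrC addKr.
  have uE : u = 1 - v by rewrite e1 addrK.
  have KvP a : K a -> (K `&` I) (a * v).
    move=> Ka; split; last exact: IM.
    by rewrite vE mulrBr mulr1; apply: left_idealB => //; exact: KM.
  apply: nIx; suff e : K `&` I = K by move: Kx; rewrite -e => -[].
  apply: minK => [||y [] //].
    split=> [|y z [Ky Iy] [Kz Iz]|a y [Ky Iy]] //.
      by split; [exact: KD|exact: ID].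
    by split; [exact: KM|exact: IM].
  exists (u :: [seq e * v | e <- s]); split.
    rewrite big_cons big_map -mulr_suml opprD addrA -vE -{1}[v]mul1r -mulrBl.
    exact: KvP.
  move=> z; rewrite inE => /orP[/eqP ->|/mapP[e se ->]].
    exists I => // a Ia; split; first exact: KM.
    by rewrite uE mulrBr mulr1; apply: left_idealB => //; exact: IM.
  have [I' mI' I'K] := sK _ se.
  by exists I' => // a I'a; rewrite mulrA; apply/KvP/I'K.
exists s; split; first exact: sKr.
by move=> e /sK[I mI IK]; exists I => // a /IK; exact: sKr.
Qed.

(** For a left ideal [K] this is K + A y_1 + ... + A y_n, where the y_i are the entries of [s]; the
    coefficients are chosen one at a time. *)
Fixpoint lspan (K : set A) (s : seq A) : set A :=
  if s is y :: s' then [set x | exists a, lspan K s' (x - a * y)] else K.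

Section Lspan.
Variable K : set A.
Hypothesis lK : left_ideal K.

Lemma lspan_left_ideal s : left_ideal (lspan K s).
Proof.
elim: s => [|y s [I0 ID IM]] //=; split=> [|x z [a xa] [b zb]|c x [a xa]].
- by exists 0; rewrite mul0r subr0.
- exists (a + b); rewrite mulrDl opprD addrACA; exact: ID.
- by exists (c * a); rewrite -mulrA -mulrBr; exact: IM.
Qed.

Lemma lspan_cons y s : lspan K s `<=` lspan K (y :: s).
Proof. by move=> x Kx; exists 0; rewrite mul0r subr0. Qed.

Lemma lspan_base s : K `<=` lspan K s.
Proof. by elim: s => // y s IH x /IH; exact: lspan_cons. Qed.

Lemma lspan_head y s : lspan K (y :: s) y.
Proof. by exists 1; rewrite mul1r subrr; case: (lspan_left_ideal s). Qed.

(** The annihilator of [y] modulo [K] contains a maximal left ideal, that is, [y] generates a simple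
    or zero submodule of A/K. *)
Definition simple_mod (y : A) : Prop :=
  exists2 I, maximal_left_ideal I & forall a, I a -> K (a * y).

(** As [a] is outside the maximal left ideal [I], 1 = b a + c with [c] in [I]. Then y = b (a y) + c
    y, where the first term is in [N] and the second in [K]. *)
Lemma simple_mod_mem (N : set A) y a : left_ideal N -> K `<=` N -> simple_mod y ->
  N (a * y) -> ~ K (a * y) -> N y.
Proof.
move=> [N0 ND NM] sKN [I [[I0 ID IM] nI1 maxI] IK] Nay nKay.
pose J : set A := fun z => exists b c, I c /\ z = b * a + c.
have [b [c [Ic e1]]] : J 1.
  apply: contrapT => nJ1; apply: nKay; apply: IK; rewrite -(maxI J)//.
  - by exists 1, 0; rewrite mul1r addr0.
  - split=> [|_ _ [u [c [Ic ->]]] [v [d [Id ->]]]|w _ [u [c [Ic ->]]]].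
    + by exists 0, 0; rewrite mul0r addr0.
    + by exists (u + v), (c + d); rewrite mulrDl addrACA; split=> //; exact: ID.
    + by exists (w * u), (w * c); rewrite mulrDr mulrA; split=> //; exact: IM.
  - by move=> c Ic; exists 0, c; rewrite mul0r add0r.
rewrite -[y]mul1r e1 mulrDl -mulrA; apply: ND; first exact: NM.
by apply: sKN; exact: IK.
Qed.

(* Simple generators each outside the span of the previous ones are independent
   modulo K, so the spans of the tails would strictly decrease. *)
Lemma simple_mod_fg (X : set A) : left_artinian A -> X `<=` simple_mod ->
  exists s : seq A, (forall y, y \in s -> X y) /\ X `<=` lspan K s.
Proof.
move=> artA X_simple; apply: contrapT => nfg.
pose T := {s : seq A | forall y, y \in s -> X y}.
have next (s : T) : exists y, X y /\ ~ lspan K (sval s) y.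
  apply: contrapT => ny; apply: nfg; exists (sval s); split; first exact: (svalP s).
  by move=> y Xy; apply: contrapT => nsy; apply: ny; exists y.
have [F FP] := choice next.
have extP (s : T) y : y \in F s :: sval s -> X y.
  rewrite inE => /orP[/eqP ->|]; first by case: (FP s).
  exact: (svalP s).
pose ext (s : T) : T := exist _ (F s :: sval s) (@extP s).
have nilP y : y \in [::] -> X y by [].
pose S n : T := iter n ext (exist _ [::] nilP).
pose y n := F (S n).
(* [seg n m] lists y_(n+m-1), ..., y_n, the latest first, which is the order in which [ext] adds
   elements. *)
pose fix seg n m := if m is m'.+1 then y (n + m')%N :: seg n m' else [::].
have segS n : sval (S n) = seg 0 n by elim: n => //= n ->.
have y_simple n : simple_mod (y n) by apply: X_simple; case: (FP (S n)).
have y_new n : ~ lspan K (seg 0 n) (y n) by rewrite -segS; case: (FP (S n)).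
have seg_mono n m p : lspan K (seg n m) `<=` lspan K (seg n (m + p)%N).
  elim: p => [|p IH] x; first by rewrite addn0.
  by rewrite addnS => /IH; exact: lspan_cons.
have seg_tail n m : lspan K (seg n m) `<=` lspan K (seg 0 (n + m)%N).
  elim: m => [|m IH] x; first by rewrite addn0; exact: lspan_base.
  by rewrite addnS => -[a] /IH xa; exists a.
(* If the last term a y_(n+m) of [x] were outside [K], then [simple_mod_mem] would put y_(n+m) in
   the span of its predecessors. *)
have indep n m x : lspan K (seg 0 n) x -> lspan K (seg n m) x -> K x.
  elim: m x => [//|m IH] x Sx /= [a Nx].
  have Kay : K (a * y (n + m)%N).
    apply: contrapT => nK; apply: (@y_new (n + m)%N).
    have lS := lspan_left_ideal (seg 0 (n + m)%N).
    apply: simple_mod_mem nK => //; first exact: lspan_base.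
    rewrite -[_ * _](subKr x); apply: left_idealB => //.
      exact: seg_mono.
    exact: seg_tail.
  rewrite -(subrK (a * y (n + m)%N) x); case: (lK) => _ KD _; apply: KD => //.
  apply: IH => //; apply: left_idealB => //; first exact: lspan_left_ideal.
  exact: lspan_base.
(* [N n] is the span modulo [K] of all y_p with p at least n. If it equals [N n.+1], then y_n lies
   in the span of later elements, so in [K] by [indep]. *)
pose N n : set A := fun x => exists m, lspan K (seg n m) x.
have seg_shift n m : lspan K (seg n.+1 m) `<=` lspan K (seg n m.+1).
  elim: m => [|m IH] x; first exact: lspan_cons.
  by move=> [a] /IH xa; exists a; rewrite -addSnnS.
have [n|n x [m Nx]|n Nn] := artA N.
- split=> [|x z [m mx] [p pz]|a x [m mx]].
  + by exists 0; case: lK.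
  + exists (m + p)%N; case: (lspan_left_ideal (seg n (m + p)%N)) => _ ID _; apply: ID.
      exact: seg_mono.
    by rewrite addnC; exact: seg_mono.
  + by exists m; case: (lspan_left_ideal (seg n m)) => _ _; apply.
- by exists m.+1; exact: seg_shift.
have [m Nm] : N n.+1 (y n).
  by rewrite Nn//; exists 1 => /=; rewrite addn0; exact: (lspan_head (y n) [::]).
apply: (@y_new n); apply: lspan_base; apply: (indep n.+1 m) => //.
exact: lspan_head.
Qed.

End Lspan.

(** Multiplying [x] in r by the decomposition of 1 from [one_sum_simple] writes it modulo r^2 as a
    sum of elements e x, each generating a simple or zero submodule of r/r^2. Then [simple_mod_fg]
    applies to the set of all such elements of r. *)
Lemma radical_fg : left_artinian A -> exists s : seq A,
  (forall y, y \in s -> r y) /\ r `<=` lspan (idealM r r) s.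
Proof.
move=> artA.
have lr : left_ideal r by case: (ideal_two_sided (jrad A)).
have lK : left_ideal (idealM r r).
  split=> [|x y|a x]; first exact: (submod0 (Defs.span _)).
    exact: (submodD (s := Defs.span _)).
  exact: idealM_Ml.
have [t [t1 tK]] := one_sum_simple artA.
pose X : set A := [set y | r y /\ simple_mod (idealM r r) y].
have [s [sX Xs]] := simple_mod_fg (X := X) lK artA (fun y => @proj2 _ _).
exists s; split=> [y /sX[]//|x rx].
have [L0 LD LM] := lspan_left_ideal lK s.
rewrite -[x]mul1r -(subrK (\sum_(e <- t) e) 1) mulrDl; apply: (LD).
  by apply: lspan_base => //; exact: idealMP.
rewrite mulr_suml big_seq; apply: (big_ind (lspan (idealM r r) s)) => // e te.
apply: Xs; split; first exact: (Defs.idealMl (I := jrad A)).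
have [I mI IK] := tK _ te; exists I => // a Ia.
by rewrite mulrA; apply: idealMP => //; exact: IK.
Qed.

End LeftArtinian.

(** * Homogeneous elements of the tensor algebra *)

Section HomogeneousElements.
Variables (k : fieldType) (R : algType k) (M : bimod R R).

Fact concat1_finite m (u : tensor_power M m) :
  finite_support (concat u (series_one M)).
Proof.
by exists m.+1 => n lt_mn; rewrite (concat1 u).2// gtn_eqF.
Qed.

(** The inclusion of the tensor power of degree [m]. Concatenating with the unit series places [u]
    in degree [m] without a cast between tensor powers. *)
Definition homog m (u : tensor_power M m) : tensor_algebra M :=
  Subm (N := direct_sum M) (concat1_finite u).

Lemma homog_comp m (u : tensor_power M m) : tcomp (homog u) m = u.
Proof. exact: (concat1 u).1. Qed.

Lemma homogP m (u : tensor_power M m) : homogeneous m (homog u).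
Proof. exact: (concat1 u).2. Qed.

Lemma homogD m (u v : tensor_power M m) : homog (u + v) = homog u + homog v.
Proof. by apply: val_inj; exact: concatDl. Qed.

Lemma homog0 m : homog (0 : tensor_power M m) = 0.
Proof. by apply: val_inj; exact: concat0l. Qed.

Lemma homog_tens m x (y : tensor_power M m) :
  homog (tens x y : tensor_power M m.+1) =
  homog (tens (Y := tensor_power M 0) x (1 : R) : tensor_power M 1) * homog y.
Proof.
apply: val_inj; rewrite [LHS]concat_tens.
transitivity (series_mul (shift x (concat (m := 0) (1 : R) (series_one M)))
  (concat y (series_one M))); last first.
  by congr series_mul; exact/esym/(concat_tens (m := 0)).
rewrite series_mul_shift; congr shift.
have -> : concat (m := 0) (1 : R) (series_one M) = series_one M.
  by apply: dprodP => n /=; exact: lact1.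
by rewrite series_mul1l.
Qed.

Lemma tcomp_homogE N (t : tensor_algebra M) :
  (forall n, (N <= n)%N -> tcomp t n = 0) -> t = \sum_(n < N) homog (tcomp t n).
Proof.
move=> t0; apply: tcompP => n.
have -> : tcomp (\sum_(m < N) homog (tcomp t m)) n =
          \sum_(m < N) tcomp (homog (tcomp t m)) n.
  by apply: (big_morph (fun u : tensor_algebra M => tcomp u n)).
have [leNn|ltnN] := leqP N n.
  by rewrite t0// big1// => m _; rewrite homogP// gtn_eqF// (leq_trans (ltn_ord m)).
rewrite (bigD1 (Ordinal ltnN)) //= homog_comp big1 ?addr0// => m nm.
by rewrite homogP//; apply: contraNneq nm => e; apply/eqP/val_inj.
Qed.

(** A component of positive degree is a sum of tensors, and by [homog_tens] each tensor is a product
    whose left factor has degree 1. *)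
Lemma idealgen_homogeneous1 (t : tensor_algebra M) :
  tcomp t 0 = 0 -> idealgen (homogeneous (M := M) 1) t.
Proof.
move=> t0 I I1; have [N tN] := submP (t : subm (direct_sum M)).
rewrite (tcomp_homogE tN); apply: (big_ind I) => [|x y|[[|n] ltnN] _ /=].
- exact: ideal0.
- exact: idealD.
- by rewrite t0 homog0; exact: ideal0.
elim/tensor_powerS_ind: (tcomp t n.+1) => [|u v IHu IHv|x y].
- by rewrite homog0; exact: ideal0.
- by rewrite homogD; exact: idealD.
- by rewrite homog_tens; apply: Defs.idealMr; apply: I1; exact: homogP.
Qed.

End HomogeneousElements.


(** * The universal property of the tensor algebra *)

Section TensorAlgebraLift.
Variables (k : fieldType) (R A : algType k) (M : bimod R R).
Variables (f : {lrmorphism R -> A}) (g : M -> A).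
Hypothesis gD : forall x y, g (x + y) = g x + g y.
Hypothesis gZ : forall c x, g (c *: x) = c *: g x.
Hypothesis g_lact : forall a x, g (lact a x) = f a * g x.
Hypothesis g_ract : forall x a, g (ract x a) = g x * f a.

Local Notation P := (dprod (fun n => bcar (tensor_power M n))).

(** The tensor of x_1, ..., x_n and a goes to g x_1 ... g x_n f a; the last factor is in [R] because
    the tensor powers are built up from degree 0. *)
Fixpoint power_lift (n : nat) : tensor_power M n -> A :=
  match n return bcar (tensor_power M n) -> A with
  | 0 => fun a => f (a : R)
  | m.+1 => tlift (fun x y => g x * power_lift (n := m) y)
  end.

(** The three properties go through one induction, because the balancedness needed in the next
    degree uses additivity and left linearity in this one. *)
Lemma power_lift_props n :
  [/\ forall u v : tensor_power M n, power_lift (u + v) = power_lift u + power_lift v,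
      forall c (u : tensor_power M n), power_lift (c *: u) = c *: power_lift u &
      forall a (u : tensor_power M n), power_lift (lact a u) = f a * power_lift u].
Proof.
elim: n => [|n [IHD IHZ IHl]].
  split=> [u v|c u|a u] /=; [exact: rmorphD|exact: linearZ|exact: rmorphM].
have bal : balanced (fun x (y : tensor_power M n) => g x * power_lift y).
  split=> [x x' y|x y y'|c x y|x s y].
  - by rewrite gD mulrDl.
  - by rewrite IHD mulrDr.
  - by rewrite gZ scalerAl.
  - by rewrite IHl g_ract mulrA.
split=> [u v|c u|a u]; [exact: tliftD|exact: tliftZ|].
rewrite /=; move: u; apply: tensor_ext => [u v|u v|x y].
- by rewrite tlactD tliftD.
- by rewrite tliftD// mulrDr.
- by rewrite tlact_tens !tlift_tens// g_lact mulrA.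
Qed.

Lemma power_liftD n (u v : tensor_power M n) :
  power_lift (u + v) = power_lift u + power_lift v.
Proof. by case: (power_lift_props n). Qed.
Lemma power_liftZ n c (u : tensor_power M n) :
  power_lift (c *: u) = c *: power_lift u.
Proof. by case: (power_lift_props n). Qed.
Lemma power_lift_lact n a (u : tensor_power M n) :
  power_lift (lact a u) = f a * power_lift u.
Proof. by case: (power_lift_props n). Qed.
Lemma power_lift0 n : power_lift (0 : tensor_power M n) = 0.
Proof. by rewrite -(scale0r 0) power_liftZ scale0r. Qed.

Lemma power_lift_tens n x (y : tensor_power M n) :
  power_lift (tens x y : tensor_power M n.+1) = g x * power_lift y.
Proof.
rewrite /= tlift_tens//; split=> [x1 x2 z|x1 z z'|c x1 z|x1 s z].
- by rewrite gD mulrDl.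
- by rewrite power_liftD mulrDr.
- by rewrite gZ scalerAl.
- by rewrite power_lift_lact g_ract mulrA.
Qed.

Lemma power_lift_sum n J (s : seq J) (p : pred J) (u : J -> tensor_power M n) :
  power_lift (\sum_(j <- s | p j) u j) = \sum_(j <- s | p j) power_lift (u j).
Proof. exact: (big_morph _ (@power_liftD n) (power_lift0 n)). Qed.

Definition partial_lift N (z : P) : A := \sum_(n < N) power_lift (z n).

Lemma partial_lift_supp N N' (z : P) : (N <= N')%N ->
  (forall n, (N <= n)%N -> z n = 0) -> partial_lift N' z = partial_lift N z.
Proof.
move=> leN z0; rewrite /partial_lift -(subnKC leN) big_split_ord /=.
rewrite [X in _ + X]big1 ?addr0// => i _.
by rewrite z0 ?power_lift0// leq_addr.
Qed.

(** Concatenation with [u] raises degrees by [m], so cutting off at m + N on the left matches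
    cutting off [z] at N. *)
Lemma partial_lift_concat m N (u : tensor_power M m) (z : P) :
  partial_lift (m + N) (concat u z) = power_lift u * partial_lift N z.
Proof.
elim: m u => [|m IH] u.
  rewrite add0n /partial_lift mulr_sumr; apply: eq_bigr => n _.
  exact: power_lift_lact.
elim/tensor_powerS_ind: u => [|u v IHu IHv|x y].
- rewrite concat0l power_lift0 mul0r; apply: big1 => n _; exact: power_lift0.
- rewrite concatDl power_liftD mulrDl -IHu -IHv -big_split.
  by apply: eq_bigr => n _; rewrite dprodD power_liftD.
- rewrite concat_tens power_lift_tens -mulrA -IH.
  rewrite addSn /partial_lift big_ord_recl [X in X + _]/= rmorph0 add0r mulr_sumr.
  by apply: eq_bigr => n _; rewrite [LHS]power_lift_tens.
Qed.

Lemma partial_lift_mul N N' (t z : P) :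
  (forall n, (N <= n)%N -> t n = 0) -> (forall n, (N' <= n)%N -> z n = 0) ->
  partial_lift (N + N') (series_mul t z) = partial_lift N t * partial_lift N' z.
Proof.
move=> t0 z0; rewrite [in LHS]/partial_lift.
under eq_bigr => n _ do rewrite (series_mulE t z (ltn_ord n)) power_lift_sum.
rewrite exchange_big big_split_ord /= [X in _ + X]big1 ?addr0 => [|i _]; last first.
  by apply: big1 => n _; rewrite t0 ?leq_addr// concat0l power_lift0.
rewrite [X in _ = X * _]/partial_lift mulr_suml; apply: eq_bigr => m _.
(* The bound on [z] is padded by N - m, so that the cutoff m + (N - m) + N' is N + N' for every
   [m]. *)
rewrite -(partial_lift_supp (N' := (N - m) + N') _ z0) ?leq_addl//.
by rewrite -partial_lift_concat addnA subnKC// ltnW.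
Qed.

(** The cutoff is an arbitrarily chosen bound on the support; by [talg_liftE] any other bound gives
    the same value. *)
Definition talg_lift (t : tensor_algebra M) : A :=
  partial_lift (projT1 (cid (submP (t : subm (direct_sum M))))) (tcomp t).

Lemma talg_liftE N (t : tensor_algebra M) :
  (forall n, (N <= n)%N -> tcomp t n = 0) -> talg_lift t = partial_lift N (tcomp t).
Proof.
rewrite /talg_lift; case: cid => N' /= t0' t0.
by rewrite -(partial_lift_supp (leq_maxl N' N) t0') (partial_lift_supp (leq_maxr N' N) t0).
Qed.

Fact talg_lift_linear : linear talg_lift.
Proof.
move=> c t u; have [N tN] := submP (t : subm (direct_sum M)).
have [N' uN] := submP (u : subm (direct_sum M)).
have t0 n : (maxn N N' <= n)%N -> tcomp t n = 0.
  by rewrite geq_max => /andP[? _]; apply: tN.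
have u0 n : (maxn N N' <= n)%N -> tcomp u n = 0.
  by rewrite geq_max => /andP[_ ?]; apply: uN.
have E n : tcomp (c *: t + u) n = c *: tcomp t n + tcomp u n by [].
rewrite (talg_liftE t0) (talg_liftE u0) (@talg_liftE (maxn N N')) => [|n nN]; last first.
  by rewrite E t0// u0// scaler0 addr0.
rewrite /partial_lift scaler_sumr -big_split; apply: eq_bigr => n _.
by rewrite E power_liftD power_liftZ.
Qed.

Fact talg_lift_monoid_morphism : monoid_morphism talg_lift.
Proof.
split=> [|t u].
  rewrite (@talg_liftE 1) => [|[]//].
  by rewrite /partial_lift big_ord_recl big_ord0 addr0 /= rmorph1.
have [N tN] := submP (t : subm (direct_sum M)).
have [N' uN] := submP (u : subm (direct_sum M)).
rewrite (talg_liftE tN) (talg_liftE uN) -(partial_lift_mul tN uN).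
apply: talg_liftE => n le_n; apply: big1 => m _.
have [leNm|ltmN] := leqP N m; first by rewrite tN// concat0l.
by apply: concat_supp uN _ _; apply: leq_trans le_n; rewrite leq_add2r ltnW.
Qed.

HB.instance Definition _ :=
  GRing.isLinear.Build k (tensor_algebra M) A _ talg_lift talg_lift_linear.
HB.instance Definition _ :=
  GRing.isMonoidMorphism.Build (tensor_algebra M) A talg_lift talg_lift_monoid_morphism.

Definition talg_lrmorphism : {lrmorphism tensor_algebra M -> A} := talg_lift.


Lemma talg_lift_homog m (u : tensor_power M m) :
  talg_lift (homog u) = power_lift u.
Proof.
rewrite (@talg_liftE m.+1) => [|n lt_mn]; last by rewrite homogP// gtn_eqF.
rewrite /partial_lift big_ord_recr big1 /= ?add0r ?homog_comp// => n _.
by rewrite homogP ?power_lift0// ltn_eqF.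
Qed.

Section Ideal.
Variable I : ideal A.
Hypothesis gI : forall x, I (g x).

Lemma power_lift_ideal n (u : tensor_power M n.+1) : I (power_lift u).
Proof.
elim/tensor_powerS_ind: u => [|u v|x y].
- by rewrite power_lift0; exact: ideal0.
- by rewrite power_liftD; exact: idealD.
- by rewrite power_lift_tens; apply: Defs.idealMr.
Qed.

Lemma talg_lift_mod (t : tensor_algebra M) : I (talg_lift t - f (tcomp t 0)).
Proof.
have [N tN] := submP (t : subm (direct_sum M)).
(* The bound is raised to [N.+1] so that there is a term of degree 0 to split off. *)
rewrite (@talg_liftE N.+1) => [|n /ltnW]; last exact: tN.
rewrite /partial_lift big_ord_recl [X in X + _]/= addrC addKr.
apply: (big_ind I) => [|x y|n _]; [exact: ideal0|exact: idealD|].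
exact: power_lift_ideal.
Qed.

(** The preimage of [I] is a two-sided ideal, and it contains the elements of degree 1 by
    [talg_lift_mod]. *)
Lemma talg_lift_ideal (t : tensor_algebra M) :
  idealgen (homogeneous (M := M) 1) t -> I (talg_lift t).
Proof.
have IP : two_sided_ideal (fun t => I (talg_lift t)).
  split=> [|x a Ix]; first split=> [|x y Ix Iy|a x Ix].
  - by rewrite rmorph0; exact: ideal0.
  - by rewrite rmorphD; exact: idealD.
  - by rewrite rmorphM; exact: Defs.idealMl.
  - by rewrite rmorphM; exact: Defs.idealMr.
move=> /(_ (Ideal IP)); apply=> u u1 /=.
by have := talg_lift_mod u; rewrite u1// rmorph0 subr0.
Qed.

Lemma talg_lift_idealX n (t : tensor_algebra M) :
  idealX (idealgen (homogeneous (M := M) 1)) n t -> idealX I n (talg_lift t).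
Proof.
elim: n t => [//|n IH] t.
pose N : submod A := Defs.span [set z | exists x y, [/\ I x, idealX I n y & z = x * y]].
apply: (idealM_map (f := talg_lift) (N := N)) => [u v|c u|u v Ju Jv].
- exact: rmorphD.
- exact: linearZ.
- by rewrite rmorphM; apply: idealMP; [exact: talg_lift_ideal|exact: IH].
Qed.

Hypothesis f_inj_mod : forall a, I (f a) -> a = 0.
Hypothesis f_onto_mod : forall x, exists a, I (x - f a).
Hypothesis g_onto_mod : forall x, I x -> exists y, idealM I I (x - g y).

(** Modulo [I] the image of [t] is [f] of its degree 0 component, so this component vanishes and
    only positive degrees remain. *)
Lemma talg_lift_kernel (t : tensor_algebra M) :
  talg_lift t = 0 -> idealgen (homogeneous (M := M) 1) t.
Proof.
move=> t0; apply: idealgen_homogeneous1; apply: f_inj_mod.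
have := talg_lift_mod t; rewrite t0 sub0r => /(submodN (N := ideal_submod I)).
by rewrite opprK.
Qed.

Lemma talg_lift_idealX_approx n x : idealX I n.+1 x ->
  exists t, idealX I n.+2 (x - talg_lift t).
Proof.
elim: n x => [|n IH] x.
  rewrite -[idealX I 2]/(idealM I (idealX I 1)) idealX1 => /g_onto_mod[y xy].
  exists (homog (tens (Y := tensor_power M 0) y (1 : R) : tensor_power M 1)).
  by rewrite talg_lift_homog power_lift_tens /= rmorph1 mulr1.
pose K : ideal A := Ideal (idealX_two_sided I n.+3).
have N0 : exists t, K (0 - talg_lift t).
  by exists 0; rewrite rmorph0 subr0; exact: ideal0.
have ND u v : (exists t, K (u - talg_lift t)) -> (exists t, K (v - talg_lift t)) ->
    exists t, K (u + v - talg_lift t).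
  move=> [t Kt] [t' Kt']; exists (t + t').
  by rewrite rmorphD opprD addrACA; exact: idealD.
have NZ c u : (exists t, K (u - talg_lift t)) -> exists t, K (c *: u - talg_lift t).
  by move=> [t Kt]; exists (c *: t); rewrite linearZ /= -scalerBr; exact: (submodZ (s := ideal_submod K)).
apply: (idealM_ind (N := Submod N0 ND NZ)) => u v Iu Iv /=.
have [y uy] := g_onto_mod Iu; have [t vt] := IH _ Iv.
exists (homog (tens (Y := tensor_power M 0) y (1 : R) : tensor_power M 1) * t).
rewrite rmorphM /= talg_lift_homog power_lift_tens /= rmorph1 mulr1.
(* The first error term lies in I^2 I^(n+1) and the second in I I^(n+2), hence both in I^(n+3). *)
have -> : u * v - g y * talg_lift t = (u - g y) * v + g y * (v - talg_lift t).
  by rewrite mulrBl mulrBr addrA subrK.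
apply: (idealD (I := K)); last by apply: idealMP.
suff : idealM (idealM I I) (idealX I n.+1) ((u - g y) * v) by rewrite idealMA.
exact: idealMP.
Qed.

Lemma talg_lift_onto n : (forall x, idealX I n x -> x = 0) ->
  forall x, exists t, talg_lift t = x.
Proof.
move=> In0 x.
(* Successive approximation: the exponent [n.+1] lets the induction start modulo [I], where elements
   of degree 0 suffice. *)
suff [t xt] : exists t, idealX I n.+1 (x - talg_lift t).
  by exists t; apply/esym/subr0_eq/In0/idealX_succ.
elim: n {In0} => [|n [t xt]].
  have [a xa] := f_onto_mod x; exists (homog (m := 0) a).
  by rewrite idealX1 talg_lift_homog.
have [t' xt'] := talg_lift_idealX_approx xt; exists (t + t').
by rewrite rmorphD opprD addrA.
Qed.

End Ideal.

End TensorAlgebraLift.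

(** * The quotient map from r to r/r^2 *)

Section RadicalLayerMap.
Variables (k : fieldType) (A : algType k).
Local Notation r := (ideal_submod (jrad A)).
Local Notation L := (rad_layer A).

(* The class of x in r/r^2; junk value 0 when x is not in the radical. *)
Definition layer (x : A) : L := qpi (rad_square A) (insubd (0 : subm r) x).

Lemma layerE (x : subm r) : layer (val x) = qpi (rad_square A) x.
Proof. by rewrite /layer valKd. Qed.

Lemma layer_subm x (rx : r x) : layer x = qpi (rad_square A) (Subm rx).
Proof. by rewrite -layerE. Qed.

Lemma layerD x y : r x -> r y -> layer (x + y) = layer x + layer y.
Proof.
move=> rx ry; rewrite (layer_subm rx) (layer_subm ry) (layer_subm (submodD rx ry)) -qpiD.
by congr qpi; exact: val_inj.
Qed.

Lemma layerZ c x : r x -> layer (c *: x) = c *: layer x.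
Proof.
move=> rx; rewrite (layer_subm rx) (layer_subm (submodZ c rx)).
rewrite -[RHS]linearZ.
by congr qpi; exact: val_inj.
Qed.

Lemma layerMl a x : r x -> layer (a * x) = lact (quotpi (jrad A) a) (layer x).
Proof.
move=> rx; rewrite (layer_subm rx) (layer_subm (Defs.idealMl a rx : r _)).
rewrite [RHS](layer_lactE a (Subm rx)).
by congr qpi; exact: val_inj.
Qed.

Lemma layerMr a x : r x -> layer (x * a) = ract (layer x) (quotpi (jrad A) a).
Proof.
move=> rx; rewrite (layer_subm rx) (layer_subm (Defs.idealMr a rx : r _)).
rewrite [RHS](layer_ractE a (Subm rx)).
by congr qpi; exact: val_inj.
Qed.

Lemma layer_eq0 x : r x -> layer x = 0 <-> idealM (jrad A) (jrad A) x.
Proof. by move=> rx; rewrite (layer_subm rx); exact: (qpi0 (rad_square A)). Qed.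

Lemma layer_onto (z : L) : exists2 x, r x & layer x = z.
Proof.
exists (val (qrepr z)); first exact: submP.
by rewrite layerE; exact: (qreprK z).
Qed.

End RadicalLayerMap.

(** * Finite generation of the bimodules A_j (r/r^2) A_i *)

Section NaturalQuiver.
Variables (k : fieldType) (A : algType k).
Local Notation Q := (quotalg (jrad A)).
Local Notation r := (ideal_submod (jrad A)).
Local Notation L := (rad_layer A).
Variable D : simple_decomposition Q.

Lemma sandwich_unit (i j : vertex D) (z : L) :
  sandwich (simple_block j) L (simple_block i) z ->
  lact (unit_component j) (ract z (unit_component i)) = z.
Proof.
move=> Sz; apply: subr0_eq.
pose F (z : L) := lact (unit_component j) (ract z (unit_component i)) - z.
apply: (spanm_map (f := F) (N := zero_submod L) _ _ _ Sz) => [u v|c u|_ [a [x [b [ja ib ->]]]]].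
- by rewrite /F ractDl lactDr opprD addrACA.
- by rewrite /F ractZl lactZr scalerBr.
have [ea _] := unit_component_mul (ja : block_ideal j a).
have [_ be] := unit_component_mul (ib : block_ideal i b).
rewrite /F /submod_set /zero_submod -lractA -ractA be -lactA ea; exact: subrr.
Qed.

Lemma sandwich_sub_bimodule (i j : vertex D) :
  sub_bimodule (simple_block j) (simple_block i)
    (Defs.span [set z | exists a x b, [/\ simple_block j a, simple_block i b &
      z = lact (B := L) a (ract x b)]]).
Proof.
split=> [a z ja|z b] Sz; last move=> Sz'.
  apply: (spanm_map (f := fun z => lact a z) (N := Defs.span _) _ _ _ Sz).
  - by move=> u v; rewrite lactDr.
  - by move=> c u; rewrite lactZr.
  move=> _ [a' [x [b [ja' ib ->]]]] N; apply; exists (a * a'), x, b.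
  by split=> //; [exact: (Defs.idealMl (I := block_ideal j))|rewrite lactA].
apply: (spanm_map (f := fun z => ract z b) (N := Defs.span _) _ _ _ Sz').
- by move=> u v; rewrite ractDl.
- by move=> c u; rewrite ractZl.
move=> _ [a' [x [b' [ja' ib ->]]]] N; apply; exists a', x, (b' * b).
split=> //; first by apply: (Defs.idealMl (I := block_ideal i)).
by rewrite -lractA ractA.
Qed.

(** With e_i and e_j the units of the blocks, the map from z to e_j z e_i carries left generators of
    r modulo r^2 to bimodule generators. *)
Lemma natural_quiver_generated (i j : vertex D) : left_artinian A ->
  exists n, generated_by j i n.
Proof.
move=> /radical_fg[s [sr rs]]; exists (size s).
pose c (z : L) := lact (unit_component j) (ract z (unit_component i)).
have cD u v : c (u + v) = c u + c v by rewrite /c ractDl lactDr.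
exists (fun l : 'I_(size s) => c (layer s`_l)); apply/seteqP; split=> z.
  move=> /(_ (Defs.span _) (sandwich_sub_bimodule i j)); apply=> _ [l _ <-] N.
  apply; exists (unit_component j), (layer s`_l), (unit_component i).
  by split=> //; exact: unit_componentP.
move=> Sz N [Nl Nr] Ng; rewrite -(sandwich_unit Sz) -/(c z).
have [x rx <-] := layer_onto z.
have Nc y : y \in s -> N (c (layer y)).
  move=> sy; apply: Ng; have lt_y : (index y s < size s)%N by rewrite index_mem.
  by exists (Ordinal lt_y) => //=; rewrite nth_index.
have {}rs := rs x rx.
elim: s x rx sr Nc rs {Ng Sz z} => [|y s IH] x rx sr Nc.
  move=> /layer_eq0-> //; rewrite /c -(scale0r 0) ractZl lactZr scale0r.
  exact: submod0.
move=> /= [a xs]; have ry : r y by apply: sr; rewrite mem_head.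
have ray : r (a * y) by exact: Defs.idealMl.
have rxay : r (x - a * y) by exact: submodB.
rewrite -(subrK (a * y) x) layerD// cD; apply: submodD.
  by apply: IH => // u su; [apply: sr|apply: Nc]; rewrite inE su orbT.
rewrite layerMl// /c -lractA -lactA.
have ja : simple_block j (unit_component j * quotpi (jrad A) a).
  exact: (Defs.idealMr (I := block_ideal j) _ (unit_componentP j)).
(* The coefficient e_j a lies in block [j], so e_j a = (e_j a) e_j acts on the generator e_j y e_i
   from within A_j. *)
rewrite -(unit_component_mul (ja : block_ideal j _)).2 lactA lractA.
by apply: Nl => //; rewrite -lractA; apply: (Nc y); rewrite mem_head.
Qed.

End NaturalQuiver.

(** * The isomorphism from the product of the blocks to A/r *)

Section BlocksSum.
Variables (k : fieldType) (Q : algType k) (D : simple_decomposition Q).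

Definition blocks_sum (a : blocks D) : Q := \sum_i block_val (a i).

(** The product lies in both ideals, so uniqueness of block components makes it 0. *)
Lemma block_mul_disjoint (i j : vertex D) x y :
  i != j -> simple_block i x -> simple_block j y -> x * y = 0.
Proof.
move=> ij ix jy; pose d (l l' : vertex D) := if l' == l then x * y else 0.
have dP l : simple_block l (x * y) -> forall l', simple_block l' (d l l').
  move=> lxy l'; rewrite /d; case: eqP => [->//|_].
  exact: (ideal0 (block_ideal l')).
have d_sum l : \sum_l' d l l' = x * y by rewrite -big_mkcond big_pred1_eq.
have ixy : simple_block i (x * y) := Defs.idealMr (I := block_ideal i) y ix.
have jxy : simple_block j (x * y) := Defs.idealMl (I := block_ideal j) x jy.
have := block_sum_uniq (dP _ ixy) (dP _ jxy) (etrans (d_sum i) (esym (d_sum j))) i.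
by rewrite /d eqxx (negPf ij).
Qed.

Lemma blocks_sum_mulr (a : blocks D) i (x : block_alg i) :
  blocks_sum a * block_val x = block_val (a i * x).
Proof.
rewrite /blocks_sum mulr_suml (bigD1 i) //= big1 ?addr0// => j ji.
by apply: (block_mul_disjoint ji); exact: block_valP.
Qed.

Lemma blocks_sum_mull (a : blocks D) i (x : block_alg i) :
  block_val x * blocks_sum a = block_val (x * a i).
Proof.
rewrite /blocks_sum mulr_sumr (bigD1 i) //= big1 ?addr0// => j ji.
by rewrite eq_sym in ji; apply: (block_mul_disjoint ji); exact: block_valP.
Qed.

Lemma sum_unit_component : \sum_(i : vertex D) unit_component i = 1.
Proof. by rewrite /unit_component; case: cid2 => f /=. Qed.

Fact blocks_sum_linear : linear blocks_sum.
Proof.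
move=> c a b; rewrite /blocks_sum scaler_sumr -big_split.
by apply: eq_bigr => i _; rewrite /= -linearP.
Qed.

Fact blocks_sum_monoid_morphism : monoid_morphism blocks_sum.
Proof.
split=> [|a b]; first exact: sum_unit_component.
rewrite [X in _ = _ * X]/blocks_sum mulr_sumr.
by apply: eq_bigr => i _; rewrite blocks_sum_mulr.
Qed.

HB.instance Definition _ :=
  GRing.isLinear.Build k (blocks D) Q _ blocks_sum blocks_sum_linear.
HB.instance Definition _ :=
  GRing.isMonoidMorphism.Build (blocks D) Q blocks_sum blocks_sum_monoid_morphism.

Lemma blocks_sum_onto q : exists a, blocks_sum a = q.
Proof.
have [f fP ->] := simple_block_sum D q.
by exists (fun i => Block (i := i) (fP i)).
Qed.

Lemma blocks_sum_inj a : blocks_sum a = 0 -> a = 0.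
Proof.
move=> a0; apply: dprodP => i; apply: block_val_inj.
rewrite (simple_block_direct (f := fun i => block_val (a i)) _ a0).
  by rewrite linear0.
by move=> j; exact: block_valP.
Qed.

End BlocksSum.

(** * The bimodule map from paths of length 1 to the radical *)

Section PathMap.
Variables (k : fieldType) (A : algType k).
Local Notation Q := (quotalg (jrad A)).
Local Notation r := (ideal_submod (jrad A)).
Local Notation L := (rad_layer A).
Variables (D : simple_decomposition Q) (rho : {lrmorphism Q -> A}).
Hypothesis rhoK : forall x, quotpi (jrad A) (rho x) = x.
Local Notation V := (vertex D).
Local Notation M := (path_bimod D).

Definition block_lift (i : V) (x : block_alg i) : A := rho (block_val x).

Lemma block_liftD i (x y : block_alg i) :
  block_lift (x + y) = block_lift x + block_lift y.
Proof. by rewrite /block_lift !linearD. Qed.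

Lemma block_liftZ i c (x : block_alg i) : block_lift (c *: x) = c *: block_lift x.
Proof. by rewrite /block_lift !linearZ. Qed.

Section ArrowMap.
Variables (i j : V) (w : A).

Definition arrow_pair (x : lreg_bimod (block_alg j)) (y : rreg_bimod (block_alg i)) : A :=
  block_lift (x : block_alg j) * w * block_lift (y : block_alg i).

Lemma arrow_pair_balanced : balanced arrow_pair.
Proof.
split=> [x x' y|x y y'|c x y|x s y]; rewrite /arrow_pair.
- by rewrite [block_lift (_ + _)]block_liftD !mulrDl.
- by rewrite [block_lift (_ + _)]block_liftD mulrDr.
- by rewrite [block_lift (_ *: _)]block_liftZ !scalerAl.
- rewrite (block_liftZ (s : k) (x : block_alg j)) (block_liftZ (s : k) (y : block_alg i)).
  by rewrite -!scalerAl -scalerAr.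
Qed.

Definition arrow_map : tensor (lreg_bimod (block_alg j)) (rreg_bimod (block_alg i)) -> A :=
  tlift arrow_pair.

Lemma arrow_mapD u v : arrow_map (u + v) = arrow_map u + arrow_map v.
Proof. exact/tliftD/arrow_pair_balanced. Qed.

Lemma arrow_mapZ c u : arrow_map (c *: u) = c *: arrow_map u.
Proof. exact/tliftZ/arrow_pair_balanced. Qed.

Lemma arrow_map0 : arrow_map 0 = 0.
Proof. by rewrite -(scale0r 0) arrow_mapZ scale0r. Qed.

Lemma arrow_map_tens x y : arrow_map (tens x y) = arrow_pair x y.
Proof. exact/tlift_tens/arrow_pair_balanced. Qed.

Lemma arrow_map_one :
  arrow_map (tens (X := lreg_bimod (block_alg j)) (Y := rreg_bimod (block_alg i))
    (1 : block_alg j) (1 : block_alg i)) =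
  rho (unit_component j) * w * rho (unit_component i).
Proof. exact: arrow_map_tens. Qed.

(** Blocks other than [j] annihilate block [j], so the sum of all components of [a] acts through
    [a j] alone. *)
Lemma arrow_map_lact (a : blocks D) u :
  arrow_map (lact (a j) u) = rho (blocks_sum a) * arrow_map u.
Proof.
move: u; apply: tensor_ext => [u v|u v|x y].
- by rewrite lactDr arrow_mapD.
- by rewrite arrow_mapD mulrDr.
rewrite [lact _ _]tlact_tens !arrow_map_tens /arrow_pair !mulrA -rmorphM.
by rewrite blocks_sum_mulr.
Qed.

Lemma arrow_map_ract u (a : blocks D) :
  arrow_map (ract u (a i)) = arrow_map u * rho (blocks_sum a).
Proof.
move: u; apply: tensor_ext => [u v|u v|x y].
- by rewrite ractDl arrow_mapD.
- by rewrite arrow_mapD mulrDl.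
rewrite [ract _ _]tract_tens !arrow_map_tens /arrow_pair -[RHS]mulrA -rmorphM.
by rewrite blocks_sum_mull.
Qed.

Lemma arrow_map_ideal u : r w -> r (arrow_map u).
Proof.
move=> rw; elim/tensor_ind: u => [|u v ru rv|x y].
- by rewrite arrow_map0; exact: submod0.
- by rewrite arrow_mapD; exact: submodD.
- by rewrite arrow_map_tens; apply: Defs.idealMr; exact: Defs.idealMl.
Qed.

End ArrowMap.

Variable w : forall e : V * V, 'I_(arrow_number e.1 e.2) -> A.

Definition path_map (m : M) : A := \sum_(e : V * V) \sum_l arrow_map (w l) (m e l).

Lemma path_mapD m m' : path_map (m + m') = path_map m + path_map m'.
Proof.
rewrite -big_split; apply: eq_bigr => e _; rewrite -big_split.
by apply: eq_bigr => l _; exact: arrow_mapD.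
Qed.

Lemma path_mapZ c m : path_map (c *: m) = c *: path_map m.
Proof.
rewrite scaler_sumr; apply: eq_bigr => e _; rewrite scaler_sumr.
by apply: eq_bigr => l _; exact: arrow_mapZ.
Qed.

Lemma path_map_lact (a : blocks D) (m : M) :
  path_map (lact a m) = (rho \o @blocks_sum k Q D) a * path_map m.
Proof.
rewrite mulr_sumr; apply: eq_bigr => e _; rewrite mulr_sumr.
by apply: eq_bigr => l _; exact: arrow_map_lact.
Qed.

Lemma path_map_ract (m : M) (a : blocks D) :
  path_map (ract m a) = path_map m * (rho \o @blocks_sum k Q D) a.
Proof.
rewrite mulr_suml; apply: eq_bigr => e _; rewrite mulr_suml.
by apply: eq_bigr => l _; exact: arrow_map_ract.
Qed.

Hypothesis w_rad : forall e (l : 'I_(arrow_number e.1 e.2)), r (w l).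

Lemma path_map_ideal m : r (path_map m).
Proof.
apply: (big_ind r) => [||e _]; [exact: submod0|exact: submodD|].
apply: (big_ind r) => [||l _]; [exact: submod0|exact: submodD|].
by apply: arrow_map_ideal; exact: w_rad.
Qed.

(** The arrow [l] as an element of the free bimodule: 1 tensor 1 in the copy indexed by [l], and 0
    in every other copy. *)
Definition path_arrow (e : V * V) (l : 'I_(arrow_number e.1 e.2)) : M :=
  let X := lreg_bimod (block_alg e.2) in let Y := rreg_bimod (block_alg e.1) in
  dfwith (T := fun e => bcar (arrow_bimod e.1 e.2)) (fun=> 0) (i := e)
    (fun l' => if l' == l then tens (X := X) (Y := Y) (1 : block_alg e.2) (1 : block_alg e.1)
               else (0 : tensor X Y)).

Lemma path_map_arrow e (l : 'I_(arrow_number e.1 e.2)) :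
  path_map (path_arrow l) = rho (unit_component e.2) * w l * rho (unit_component e.1).
Proof.
rewrite /path_map (bigD1 e) //= (bigD1 l) //= [X in _ + X]big1 ?addr0 => [|e' e'e].
  rewrite big1 ?addr0 => [|l' l'l].
    by rewrite /path_arrow dfwith_in eqxx arrow_map_one.
  by rewrite /path_arrow dfwith_in (negPf l'l) arrow_map0.
apply: big1 => l' _; rewrite /path_arrow dfwith_out 1?eq_sym//.
exact: arrow_map0.
Qed.

Hypothesis w_gen : forall e : V * V,
  bimod_gen (simple_block e.2) (simple_block e.1) (range (fun l : 'I_(arrow_number e.1 e.2) => layer (w l))) =
  sandwich (simple_block e.2) L (simple_block e.1).

(** The image of [path_map] in r/r^2 is a sub-bimodule over A/r, because [blocks_sum] is onto. It
    contains generators of every A_j (r/r^2) A_i, and these add up to r/r^2. *)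
Lemma path_map_onto_layer x : r x ->
  exists m, idealM (jrad A) (jrad A) (x - path_map m).
Proof.
move=> rx.
suff [m mx] : exists m, layer (path_map m) = layer x.
  exists m; apply/layer_eq0; first exact: submodB (path_map_ideal m).
  rewrite layerD// ?mx; last first.
    by apply: (submodN (N := r)); exact: path_map_ideal.
  by rewrite -scaleN1r layerZ ?mx ?scaleN1r ?subrr//; exact: path_map_ideal.
have N0 : exists m, layer (path_map m) = 0.
  by exists 0; rewrite -(scale0r 0) path_mapZ layerZ ?scale0r//; exact: path_map_ideal.
have ND u v : (exists m, layer (path_map m) = u) -> (exists m, layer (path_map m) = v) ->
    exists m, layer (path_map m) = u + v.
  move=> [m <-] [m' <-]; exists (m + m').
  by rewrite path_mapD layerD//; exact: path_map_ideal.
have NZ c u : (exists m, layer (path_map m) = u) -> exists m, layer (path_map m) = c *: u.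
  move=> [m <-]; exists (c *: m).
  by rewrite path_mapZ layerZ//; exact: path_map_ideal.
pose N : submod L := Submod N0 ND NZ.
have Nl q u : N u -> N (lact q u).
  move=> [m <-]; have [a <-] := blocks_sum_onto D q; exists (lact a m).
  by rewrite path_map_lact layerMl ?rhoK//; exact: path_map_ideal.
have Nr q u : N u -> N (ract u q).
  move=> [m <-]; have [a <-] := blocks_sum_onto D q; exists (ract m a).
  by rewrite path_map_ract layerMr ?rhoK//; exact: path_map_ideal.
have Nsand (e : V * V) (z : L) :
    sandwich (simple_block e.2) L (simple_block e.1) z -> N z.
  have Sw l : sandwich (simple_block e.2) L (simple_block e.1) (layer (w (e := e) l)).
    by rewrite -w_gen => N' _; apply; exists l.
  rewrite -w_gen => /(_ N); apply; first by split=> [a u _|u b _]; [exact: Nl|exact: Nr].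
  move=> _ [l _ <-]; exists (path_arrow l).
  (* The arrow is sent to e_j w e_i with lifted units; its class equals that of [w l], which lies in
     A_j (r/r^2) A_i. *)
  have rw := @w_rad e l; rewrite path_map_arrow layerMr; last exact: Defs.idealMl.
  by rewrite layerMl// !rhoK -lractA; exact: sandwich_unit.
suff : N (layer x) by [].
have lD a b : lact (a + b) (layer x) = lact a (layer x) + lact b (layer x).
  exact: lactDl.
(* Writing 1 as the sum of the block units on the left, and below on the right, splits the class of
   [x] into pieces e_j x e_i. *)
rewrite -[layer x]lact1 -(sum_unit_component D).
rewrite (big_morph (fun a => lact a (layer x)) lD (lact0l _)).
apply: (big_ind N) => [||j _]; [exact: submod0|exact: submodD|].
have rD a b : ract (lact (unit_component j) (layer x)) (a + b) =
    ract (lact (unit_component j) (layer x)) a + ract (lact (unit_component j) (layer x)) b.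
  exact: ractDr.
rewrite -[lact _ _]ract1 -(sum_unit_component D).
rewrite (big_morph (fun a => ract (lact (unit_component j) (layer x)) a) rD (ract0r _)).
apply: (big_ind N) => [||i _]; [exact: submod0|exact: submodD|].
apply: (Nsand (i, j)) => N' ; apply; exists (unit_component j), (layer x), (unit_component i).
by rewrite lractA; split=> //; exact: unit_componentP.
Qed.

End PathMap.

(** * Construction of the homomorphism and the bounds on its kernel *)

Theorem theorem3p4 (k : fieldType) (A : algType k)
    (D : simple_decomposition (quotalg (jrad A))) :
  left_artinian A -> splits_over_radical A ->
  exists phi : {lrmorphism gpa D -> A},
    (forall a : A, exists t : gpa D, phi t = a) /\
    exists s : nat, [/\ (0 < s)%N,
      idealX (gpa_ideal D) s `<=` kernel phi &
      kernel phi `<=` gpa_ideal D].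
Proof.
move=> artA [rho rhoK]; have [n rn0] := jacobson_nilpotent artA.
have arrow_gen (e : vertex D * vertex D) : generated_by e.2 e.1 (arrow_number e.1 e.2).
  (* Finite generation rules out the default value 0, so the arrow number is attained by an actual
     generating family. *)
  rewrite /arrow_number; case: pselect => [fg|[]].
    by case: ex_minnP => m /asboolP.
  have [m gm] := natural_quiver_generated e.1 e.2 artA.
  by exists m; apply/asboolP.
pose gens e := projT1 (cid (arrow_gen e)).
pose w (e : vertex D * vertex D) l : A := val (qrepr (gens e l)).
have w_layer e l : layer (w e l) = gens e l.
  by rewrite /w layerE; exact: (qreprK (gens e l)).
have w_rad e l : ideal_submod (jrad A) (w e l) by exact: submP.
have w_gen (e : vertex D * vertex D) :
    bimod_gen (simple_block e.2) (simple_block e.1) (range (fun l => layer (w e l))) =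
    sandwich (simple_block e.2) (rad_layer A) (simple_block e.1).
  have -> : (fun l => layer (w e l)) = gens e by apply/funext => l; exact: w_layer.
  exact: projT2 (cid (arrow_gen e)).
have gI := path_map_ideal rho w_rad.
pose f : {lrmorphism blocks D -> A} := rho \o @blocks_sum k _ D.
have fI a : jrad A (f a) -> a = 0.
  by move=> /quotpi0; rewrite rhoK; exact: blocks_sum_inj.
have fO x : exists a, jrad A (x - f a).
  have [a ax] := blocks_sum_onto D (quotpi (jrad A) x); exists a.
  by apply/quotpi_eq; rewrite -ax; exact/esym/rhoK.
have gO := path_map_onto_layer rhoK w_rad w_gen.
have gD := path_mapD rho w; have gZ := path_mapZ rho w.
have gl := path_map_lact rho w; have gr := path_map_ract rho w.
pose phi : {lrmorphism gpa D -> A} := talg_lrmorphism gD gZ gl gr.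
exists phi; split.
  exact (talg_lift_onto gD gZ gl gr gI fO gO rn0).
(* Since r^n = 0, the exponent n + 1 also works, and it is visibly positive. *)
exists n.+1; split=> // [t Jt|t].
  apply: rn0; apply: idealX_succ; exact: (talg_lift_idealX gD gZ gl gr gI Jt).
exact: (talg_lift_kernel gD gZ gl gr gI fI).
Qed.
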